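(* Let $N\in\mathbb{N}$. The following growth and decay estimates hold as $i,j,k\to+\infty$. (a) If at least one of the four combinations $\omega_i\pm\omega_j\pm\omega_k$ does not tend to $\infty$, then each of $\omega_i\mathbb{H}_{0jki}$, $\omega_i\mathbb{G}_{jki}$, $\omega_i\overline{\mathbb{G}}_{jki}$ is $\mathcal{O}(\omega_i\omega_k)$. (b) If all four combinations $\omega_i\pm\omega_j\pm\omega_k\to\infty$, then $$\omega_i\mathbb{H}_{0jki}=\sum_\pm\mathcal{O}\left(\frac{\omega_i}{(\omega_i\pm\omega_j\pm\omega_k)^N}\right),$$ and each of $\omega_i\mathbb{G}_{jki}$ and $\omega_i\overline{\mathbb{G}}_{jki}$ is $$\sum_\pm\mathcal{O}\left(\frac{\omega_i}{(\omega_i\pm\omega_j\pm\omega_k)^2}\right).$$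
   Context: For integers $i\ge 0$ and $x\in[0,\pi/2]$ set $\omega_i:=3+2i$ and $$e_i(x):=2\frac{\sqrt{i!\,(i+2)!}}{\Gamma(i+\frac32)}\cos^3(x)\,P_i^{(\frac12,\frac32)}(\cos(2x)),$$ where $P_i^{(\alpha,\beta)}$ are the Jacobi polynomials (Szegő's normalization); $e_i'$ is the derivative of $e_i$. The Fourier constants are $$\mathbb{H}_{0jki}:=\int_0^{\pi/2}e_0e_ie_je_k\tan^2dx,\qquad \mathbb{G}_{jki}:=\int_0^{\pi/2}e_ie_je_k\tan^2dx,\qquad \overline{\mathbb{G}}_{jki}:=\int_0^{\pi/2}e_k\frac{e_j'}{\omega_j}\frac{e_i'}{\omega_i}\tan^2dx.$$ Conventions. $\omega_i\pm\omega_j\pm\omega_k$ stands for all four combinations of signs (with $\omega_i$ having sign $+$) and $\sum_\pm$ is the sum over all of them. The estimates are understood along arbitrary sequences of triples $(i,j,k)$ with all indices tending to $+\infty$; ''$\to\infty$'' for a combination means that it tends to $+\infty$ along the sequence. $\sum_\pm\mathcal{O}(f_\pm)$ denotes a quantity bounded in absolute value, for all sufficiently large indices along the sequence, by a constant (possibly depending on $N$) times $\sum_\pm|f_\pm|$. *)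

(* Defs.v *)
From Stdlib Require Import Reals Arith.
From Coquelicot Require Import Coquelicot.
Open Scope R_scope.

(* Euler's integral of the second kind, for x > 0. *)
Definition Gamma (x : R) : R :=
  RInt_gen (fun t => Rpower t (x - 1) * exp (- t))
    (at_right 0) (Rbar_locally p_infty).

(* Binomial coefficient a (a-1) ... (a-k+1) / k! with real upper argument. *)
Fixpoint gbinom (a : R) (k : nat) : R :=
  match k with
  | O => 1
  | S k' => gbinom a k' * (a - INR k') / INR k
  end.

(* Szegő's explicit formula, Orthogonal Polynomials (4.3.2); the
   normalization is P_n(1) = gbinom (n + alpha) n. *)
Definition jacobi (alpha beta : R) (n : nat) (x : R) : R :=
  sum_n (fun s : nat =>
    gbinom (INR n + alpha) (n - s) * gbinom (INR n + beta) s
    * ((x - 1) / 2) ^ s * ((x + 1) / 2) ^ (n - s)) n.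

Definition omega (i : nat) : R := 3 + 2 * INR i.

Definition e (i : nat) (x : R) : R :=
  2 * (sqrt (INR (fact i) * INR (fact (i + 2))) / Gamma (INR i + 3 / 2))
  * cos x ^ 3 * jacobi (1 / 2) (3 / 2) i (cos (2 * x)).

(* At x = PI / 2 the term [tan x] is a meaningless value (division by zero),
   but every integrand below has the factor [e k x], which vanishes there. *)
Definition H0 (j k i : nat) : R :=
  RInt (fun x => e 0 x * e i x * e j x * e k x * tan x ^ 2) 0 (PI / 2).

Definition G (j k i : nat) : R :=
  RInt (fun x => e i x * e j x * e k x * tan x ^ 2) 0 (PI / 2).

Definition Gbar (j k i : nat) : R :=
  RInt (fun x => e k x * (Derive (e j) x / omega j)
                 * (Derive (e i) x / omega i) * tan x ^ 2) 0 (PI / 2).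

Definition is_sign (s : R) : Prop := s = 1 \/ s = -1.

Definition omega_comb (s t : R) (i j k : nat) : R :=
  omega i + s * omega j + t * omega k.

Definition sum_pm (f : R -> R -> R) : R :=
  f 1 1 + f 1 (-1) + f (-1) 1 + f (-1) (-1).

Definition is_bigO (u v : nat -> R) : Prop :=
  exists C : R, eventually (fun n => Rabs (u n) <= C * Rabs (v n)).

(* u = sum over the four sign choices of O(f s t). *)
Definition is_sum_bigO (u : nat -> R) (f : R -> R -> nat -> R) : Prop :=
  is_bigO u (fun n => sum_pm (fun s t => Rabs (f s t n))).

Definition tends_to_infty (i : nat -> nat) : Prop :=
  filterlim i eventually eventually.

Definition all_combs_to_infty (i j k : nat -> nat) : Prop :=
  forall s t : R, is_sign s -> is_sign t ->
    is_lim_seq (fun n => omega_comb s t (i n) (j n) (k n)) p_infty.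

(* Main.v *)
Require Import Defs.
From Stdlib Require Import Reals.
From Stdlib Require Import Arith Lra Lia.
From Coquelicot Require Import Coquelicot.
Open Scope R_scope.

(** The Jacobi polynomials with parameters 1/2 and 3/2 are elementary: with
w = omega i,
   e_i(x) = c_i E_i(x),   E_i(x) = w sin(w x) cot x - cos(w x),
where c_i is of size 1/w ([e_eigE], [normc_bound]).  The powers of tan x in the
three integrands are absorbed by
   F_i = E_i tan x = w sin(w x) - cos(w x) tan x   and
   D_i = E_i' tan x / w = w cos(w x) - sin(w x) cot x,
which, like E_i, are trigonometric polynomials because w is an odd integer.
Up to the constants c, the three integrals are those of E_0 F_i F_j E_k,
F_i F_j E_k and D_i D_j E_k.

Growth.  |F_i| and |D_i| are at most 2 w and |E_k| is at most 2 omega_k^2, so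
after multiplication by the constants c every integral is O(omega_k), whatever
the three indices are ([growth_bounds]).

Decay.  When all four combinations are large, so is
m = omega_i - omega_j - omega_k; it is an odd positive integer 2 p + 1, and it
suffices to bound the integrals by powers of 1/m, the corresponding summand
being one of the four on the right-hand side.

For H, E_0 = 8 cos^3 x provides one factor cos x for each of F_i, F_j, E_k and
turns them into trigonometric polynomials with even frequencies.  Those of
cos x F_i exceed the sum of all the others as soon as m > 3, and cosines of
distinct even frequencies are orthogonal on [0, pi/2]: H is eventually equal
to 0 ([H0_zero]), which beats every power of 1/m.

For G, put X = omega_i, Y = omega_j, Z = omega_k.  The product-to-sum formulas
write F_i F_j E_k / (X Y Z) as a signed sum over the four odd frequencies
n = X + s Y + t Z ([FFE_pointwise]).  In the summand of n there is
sin(n x) cot x; the other terms have an elementary primitive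
([is_derive_antider]).  The integral of sin(n x) cot x is, up to an alternating
correction -(-1)^p / n^2 and an error O(1/n^3), independent of n
([cot_int_corr_close]); with the signs of the four summands the constants
cancel.  What remains is a rational function of X, Y, Z, in which the sum over
the signs produces massive cancellations ([sign_sum_rat_part]).  The result
([RInt_FFE_bound]) is
   |integral of F_i F_j E_k| <= 4 X Y Z / m^2 * Y / (Y + m),
which is more than G needs; the additional factor is there for the last
integral.

For Gbar, integration by parts and the eigenvalue equation
(tan^2 x E_i')' = - X^2 tan^2 x E_i give the exact relation
   2 X Y (integral of D_i D_j E_k)
     = (X^2 + Y^2 - Z^2) (integral of F_i F_j E_k)
([RInt_DDE_FFE]).  The ratio (X^2 + Y^2 - Z^2) / (2 X Y) is not bounded, but
it is at most 2 (Y + m) / Y, which the factor Y / (Y + m) compensates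
([decay_bounds]). *)

(** * Quotients sin(n x) / sin x and cos(n x) / cos x for odd n *)

Definition oddR (p : nat) : R := 2 * INR p + 1.

(** The trigonometric polynomials sin((2p+1)x) / sin x and
cos((2p+1)x) / cos x ([sinq_spec], [cosq_spec]). *)
Fixpoint sinq (p : nat) (x : R) : R :=
  match p with
  | O => 1
  | S p' => sinq p' x + 2 * cos (2 * INR p * x)
  end.

Fixpoint cosq (p : nat) (x : R) : R :=
  match p with
  | O => 1
  | S p' => 2 * cos (2 * INR p * x) - cosq p' x
  end.

Lemma oddR_S p : oddR (S p) = oddR p + 2.
Proof. unfold oddR; rewrite S_INR; ring. Qed.

Lemma oddR_ge1 p : 1 <= oddR p.
Proof. unfold oddR; pose proof (pos_INR p); lra. Qed.

Lemma omega_oddR k : omega k = oddR (S k).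
Proof. unfold omega, oddR; rewrite S_INR; ring. Qed.

Lemma omega_ge3 k : 3 <= omega k.
Proof. unfold omega; pose proof (pos_INR k); lra. Qed.

Lemma sinq_spec p x : sin x * sinq p x = sin (oddR p * x).
Proof.
induction p as [|p IH].
- simpl; unfold oddR; simpl; rewrite Rmult_1_r; f_equal; ring.
- simpl sinq; rewrite Rmult_plus_distr_l, IH.
  replace (oddR p * x) with (2 * INR (S p) * x - x) by (unfold oddR; rewrite S_INR; ring).
  replace (oddR (S p) * x) with (2 * INR (S p) * x + x) by (unfold oddR; ring).
  change (match p with 0%nat => 1 | S _ => INR p + 1 end) with (INR (S p)).
  rewrite sin_plus, sin_minus; ring.
Qed.

Lemma cosq_spec p x : cos x * cosq p x = cos (oddR p * x).
Proof.
induction p as [|p IH].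
- simpl; unfold oddR; simpl; rewrite Rmult_1_r; f_equal; ring.
- simpl cosq; rewrite Rmult_minus_distr_l, IH.
  replace (oddR p * x) with (2 * INR (S p) * x - x) by (unfold oddR; rewrite S_INR; ring).
  replace (oddR (S p) * x) with (2 * INR (S p) * x + x) by (unfold oddR; ring).
  change (match p with 0%nat => 1 | S _ => INR p + 1 end) with (INR (S p)).
  rewrite cos_plus, cos_minus; ring.
Qed.

Lemma abs_cos_le1 x : Rabs (cos x) <= 1.
Proof. apply Rabs_le; apply COS_bound. Qed.
Lemma abs_sin_le1 x : Rabs (sin x) <= 1.
Proof. apply Rabs_le; apply SIN_bound. Qed.

Lemma sinq_bound p x : Rabs (sinq p x) <= oddR p.
Proof.
induction p as [|p IH].
- simpl; unfold oddR; simpl; rewrite Rabs_R1; lra.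
- rewrite oddR_S; simpl sinq; eapply Rle_trans; [apply Rabs_triang|].
  rewrite Rabs_mult, (Rabs_pos_eq 2) by lra.
  pose proof (abs_cos_le1 (2 * INR (S p) * x)) as Hc; simpl INR in Hc; lra.
Qed.

Lemma cosq_bound p x : Rabs (cosq p x) <= oddR p.
Proof.
induction p as [|p IH].
- simpl; unfold oddR; simpl; rewrite Rabs_R1; lra.
- rewrite oddR_S; simpl cosq; eapply Rle_trans; [apply Rabs_triang|].
  rewrite Rabs_Ropp, Rabs_mult, (Rabs_pos_eq 2) by lra.
  pose proof (abs_cos_le1 (2 * INR (S p) * x)) as Hc; simpl INR in Hc; lra.
Qed.

Lemma continuous_cos_lin a x : continuous (fun y => cos (a * y)) x.
Proof. apply (ex_derive_continuous (fun y => cos (a * y))); auto_derive; trivial. Qed.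
Lemma continuous_sin_lin a x : continuous (fun y => sin (a * y)) x.
Proof. apply (ex_derive_continuous (fun y => sin (a * y))); auto_derive; trivial. Qed.

Lemma continuous_Rplus (f g : R -> R) x :
  continuous f x -> continuous g x -> continuous (fun y => f y + g y) x.
Proof. intros; apply (continuous_plus f g); assumption. Qed.
Lemma continuous_Rminus (f g : R -> R) x :
  continuous f x -> continuous g x -> continuous (fun y => f y - g y) x.
Proof. intros; apply (continuous_minus f g); assumption. Qed.
Lemma continuous_Rmult (f g : R -> R) x :
  continuous f x -> continuous g x -> continuous (fun y => f y * g y) x.
Proof. intros; apply (continuous_mult f g); assumption. Qed.

Lemma continuous_sinq p x : continuous (sinq p) x.
Proof.
induction p as [|p IH].
- apply continuous_const.
- change (continuous (fun y => sinq p y + 2 * cos (2 * INR (S p) * y)) x).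
  apply continuous_Rplus; [exact IH|].
  apply continuous_Rmult; [apply continuous_const|apply continuous_cos_lin].
Qed.

Lemma continuous_cosq p x : continuous (cosq p) x.
Proof.
induction p as [|p IH].
- apply continuous_const.
- change (continuous (fun y => 2 * cos (2 * INR (S p) * y) - cosq p y) x).
  apply continuous_Rminus; [|exact IH].
  apply continuous_Rmult; [apply continuous_const|apply continuous_cos_lin].
Qed.

Ltac cont :=
  repeat lazymatch goal with
    | |- continuous (fun y => ?f - ?g) _ =>
        apply (continuous_Rminus (fun y => f) (fun y => g))
    | |- continuous (fun y => ?f + ?g) _ =>
        apply (continuous_Rplus (fun y => f) (fun y => g))
    | |- continuous (fun y => ?f * ?g) _ =>
        apply (continuous_Rmult (fun y => f) (fun y => g))
    | |- continuous (fun y => sin (?a * y)) _ => apply continuous_sin_lin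
    | |- continuous (fun y => cos (?a * y)) _ => apply continuous_cos_lin
    | |- continuous (fun y => sin y) _ => apply continuous_sin
    | |- continuous (fun y => cos y) _ => apply continuous_cos
    | |- continuous (fun y => sinq ?p y) _ => apply continuous_sinq
    | |- continuous (fun y => cosq ?p y) _ => apply continuous_cosq
    | |- continuous (fun y => ?f) _ => apply continuous_const
  end.

(** * Two integration tools *)

Lemma ex_RInt_cont (f : R -> R) (a b : R) :
  (forall x, continuous f x) -> ex_RInt f a b.
Proof. intros Hf; apply (ex_RInt_continuous f a b); intros; apply Hf. Qed.

(** Differentiability inside the interval is enough: formulas with tan x or
1 / sin x can be used for the derivative although they make no sense at the
ends.  The difference between f and the integral of df is continuous with zero
derivative inside, hence constant by the mean value theorem. *)
Lemma is_RInt_derive_open (f df : R -> R) (a b : R) :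
  a < b ->
  (forall x, continuous f x) ->
  (forall x, continuous df x) ->
  (forall x, a < x < b -> is_derive f x (df x)) ->
  is_RInt df a b (f b - f a).
Proof.
intros Hab Hf Hdf Hd.
assert (Hop : forall x, is_derive (fun y => RInt df a y) x (df x)).
{ intros x. apply (is_derive_RInt df (fun y => RInt df a y) a x); [|apply Hdf].
  apply filter_forall; intros y; apply (RInt_correct df), ex_RInt_cont, Hdf. }
destruct (MVT_gen (fun y => f y - RInt df a y) a b (fun _ => 0)) as [c [_ Hc]].
- rewrite Rmin_left, Rmax_right by lra; intros x Hx.
  replace 0 with (minus (df x) (df x)) by (unfold minus, plus, opp; simpl; ring).
  apply (is_derive_minus f (fun y => RInt df a y)); [apply Hd; assumption|apply Hop].
- intros x _.
  apply continuity_pt_filterlim, (continuous_Rminus f (fun y => RInt df a y)); [apply Hf|].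
  apply (ex_derive_continuous (fun y => RInt df a y)); eexists; apply Hop.
- rewrite RInt_point in Hc; unfold zero in Hc; simpl in Hc.
  replace (f b - f a) with (RInt df a b) by lra.
  apply (RInt_correct df), ex_RInt_cont, Hdf.
Qed.

(** * The eigenfunctions in closed form *)

(** On (0, pi/2) these are omega sin(omega x) cot x - cos(omega x), its product
with tan x, and tan x / omega times its derivative.  They are written with
[sinq] and [cosq] so as to be continuous everywhere, in particular at both ends
of the interval of integration, where the integrands with tan are not. *)
Definition eigE (k : nat) (x : R) : R :=
  omega k * (cos x * sinq (S k) x) - cos (omega k * x).

Definition eigF (k : nat) (x : R) : R :=
  omega k * sin (omega k * x) - sin x * cosq (S k) x.
Definition eigD (k : nat) (x : R) : R :=
  omega k * cos (omega k * x) - cos x * sinq (S k) x.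

Lemma INR_S_neq0 k : INR (S k) <> 0.
Proof. apply not_0_INR; lia. Qed.

Lemma gbinom_S a k : gbinom a (S k) = gbinom a k * (a - INR k) / INR (S k).
Proof. reflexivity. Qed.

Lemma gbinom_pascal a k :
  gbinom (a + 1) (S k) = gbinom a k + gbinom a (S k).
Proof.
induction k as [|k IH].
- simpl; field.
- rewrite (gbinom_S (a + 1) (S k)), IH, !gbinom_S.
  pose proof (INR_S_neq0 k); pose proof (INR_S_neq0 (S k)).
  rewrite (S_INR (S k)), (S_INR k) in *; field; lra.
Qed.

Lemma gbinom_nat_fact q k :
  gbinom (INR (q + k)) k * (INR (fact q) * INR (fact k)) = INR (fact (q + k)).
Proof.
revert q; induction k as [|k IH]; intros q.
- simpl; rewrite Nat.add_0_r; ring.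
- rewrite gbinom_S; replace (q + S k)%nat with (S q + k)%nat by lia.
  rewrite <- IH.
  rewrite (fact_simpl q), (fact_simpl k), !mult_INR.
  replace (INR (S q + k) - INR k) with (INR (S q)) by (rewrite plus_INR; ring).
  field; apply INR_S_neq0.
Qed.

Lemma gbinom_nat_gt n k : (n < k)%nat -> gbinom (INR n) k = 0.
Proof.
induction k as [|k IH]; intros Hk; [lia|].
rewrite gbinom_S; destruct (Nat.eq_dec n k) as [->|Hn].
- replace (INR k - INR k) with 0 by ring; unfold Rdiv; ring.
- rewrite IH by lia; unfold Rdiv; ring.
Qed.

(** The binomial expansion of de Moivre's formula, where T k is to be
sin(th + k pi/2). *)
Definition binsum (c s : R) (n : nat) (T : nat -> R) : R :=
  sum_f_R0 (fun k => gbinom (INR n) k * c ^ (n - k) * s ^ k * T k) n.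

(** Pascal's rule.  Splitting off the first term of one sum and the last of the
other aligns the powers; the vanishing of gbinom n (n+1) supplies the missing
term. *)
Lemma binsum_S c s n T :
  binsum c s (S n) T = c * binsum c s n T + s * binsum c s n (fun k => T (S k)).
Proof.
unfold binsum; rewrite (decomp_sum _ (S n)) by lia; simpl pred.
rewrite (sum_eq _ (fun k => (gbinom (INR n) k * c ^ (n - k) * s ^ k * T (S k)) * s
                     + gbinom (INR n) (S k) * c ^ (n - k) * s ^ S k * T (S k))).
2:{ intros k _; rewrite S_INR, gbinom_pascal; simpl; ring. }
rewrite sum_plus, <- scal_sum.
enough (H : c * sum_f_R0 (fun k => gbinom (INR n) k * c ^ (n - k) * s ^ k * T k) n
  = gbinom (INR n) 0 * c ^ (S n - 0) * s ^ 0 * T 0%nat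
    + sum_f_R0 (fun k => gbinom (INR n) (S k) * c ^ (n - k) * s ^ S k * T (S k)) n)
  by (rewrite H; simpl; ring).
destruct n as [|n]; [simpl; field|].
rewrite (decomp_sum _ (S n)), tech5 by lia; simpl pred.
rewrite (gbinom_nat_gt (S n) (S (S n))) by lia.
rewrite Rmult_plus_distr_l, scal_sum.
rewrite (sum_eq _ (fun k => gbinom (INR (S n)) (S k) * c ^ (S n - k) * s ^ S k * T (S k))
  n).
- rewrite !Nat.sub_0_r; simpl; ring.
- intros k Hk; replace (S n - k)%nat with (S (S n - S k)) by lia.
  rewrite <- (tech_pow_Rmult c); ring.
Qed.

(** The phase th makes the induction go through: the addition formula for the
last x involves a cosine, which is a sine with th shifted by pi/2.  It also
covers the cosine. *)
Lemma sin_binsum n : forall x th,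
  sin (INR n * x + th)
  = binsum (cos x) (sin x) n (fun k => sin (th + INR k * (PI / 2))).
Proof.
induction n as [|n IH]; intros x th.
- unfold binsum; simpl; rewrite !Rmult_0_l, Rplus_0_l, Rplus_0_r; ring.
- replace (INR (S n) * x + th) with ((INR n * x + th) + x) by (rewrite S_INR; ring).
  rewrite sin_plus.
  replace (cos (INR n * x + th)) with (sin (INR n * x + (th + PI / 2))).
  2:{ rewrite <- Rplus_assoc, sin_plus, cos_PI2, sin_PI2; ring. }
  rewrite !IH, binsum_S.
  replace (binsum (cos x) (sin x) n (fun k => sin (th + PI / 2 + INR k * (PI / 2))))
    with (binsum (cos x) (sin x) n (fun k => sin (th + INR (S k) * (PI / 2)))); [ring|].
  apply sum_eq; intros k _; do 2 f_equal; rewrite S_INR; ring.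
Qed.

Lemma sum_even_odd (f : nat -> R) m :
  sum_f_R0 f (2 * m + 1) = sum_f_R0 (fun l => f (2 * l)%nat + f (2 * l + 1)%nat) m.
Proof.
induction m as [|m IH]; [reflexivity|].
replace (2 * S m + 1)%nat with (S (S (2 * m + 1))) by lia.
rewrite !tech5, IH; replace (S (2 * m + 1)) with (2 * S m)%nat by lia.
replace (S (2 * S m)) with (2 * S m + 1)%nat by lia; ring.
Qed.

Lemma sin_nat_PI l : sin (INR l * PI) = 0.
Proof. 
induction l as [|l IH]; [simpl; rewrite Rmult_0_l; apply sin_0|].
rewrite S_INR, Rmult_plus_distr_r, Rmult_1_l, neg_sin, IH; ring.
Qed.

Lemma cos_nat_PI l : cos (INR l * PI) = (-1) ^ l.
Proof. 
induction l as [|l IH]; [simpl; rewrite Rmult_0_l; apply cos_0|].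
rewrite S_INR, Rmult_plus_distr_r, Rmult_1_l, neg_cos, IH; simpl; ring.
Qed.

Lemma sin_odd_PI2 p : sin (oddR p * (PI / 2)) = (-1) ^ p.
Proof.
replace (oddR p * (PI / 2)) with (INR p * PI + PI / 2) by (unfold oddR; field).
rewrite sin_plus, sin_PI2, cos_PI2, cos_nat_PI; ring.
Qed.

Lemma cos_odd_PI2 p : cos (oddR p * (PI / 2)) = 0.
Proof.
replace (oddR p * (PI / 2)) with (INR p * PI + PI / 2) by (unfold oddR; field).
rewrite cos_plus, sin_PI2, cos_PI2, sin_nat_PI; ring.
Qed.

Lemma oddR_INR m : oddR m = INR (2 * m + 1).
Proof. unfold oddR; rewrite plus_INR, mult_INR; reflexivity. Qed.

Lemma sin_odd_binsum m x :
  sin (oddR m * x) = sum_f_R0 (fun l =>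
    gbinom (oddR m) (2 * l + 1) * cos x ^ (2 * (m - l)) * sin x ^ (2 * l + 1) * (-1) ^ l) m.
Proof.
rewrite oddR_INR, <- (Rplus_0_r (INR _ * x)), sin_binsum; unfold binsum.
rewrite sum_even_odd; apply sum_eq; intros l Hl.
replace (2 * m + 1 - (2 * l + 1))%nat with (2 * (m - l))%nat by lia.
replace (INR (2 * l) * (PI / 2)) with (INR l * PI) by (rewrite mult_INR; simpl; field).
replace (INR (2 * l + 1) * (PI / 2)) with (oddR l * (PI / 2))
  by (unfold oddR; rewrite plus_INR, mult_INR; reflexivity).
rewrite !Rplus_0_l, sin_nat_PI, sin_odd_PI2; ring.
Qed.

Lemma cos_odd_binsum m x :
  cos (oddR m * x) = sum_f_R0 (fun l =>
    gbinom (oddR m) (2 * l) * cos x ^ (2 * (m - l) + 1) * sin x ^ (2 * l) * (-1) ^ l) m.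
Proof.
assert (Hm : oddR m = INR (2 * m + 1)) by (unfold oddR; rewrite plus_INR, mult_INR; reflexivity).
replace (cos (oddR m * x)) with (sin (oddR m * x + PI / 2))
  by (rewrite sin_plus, sin_PI2, cos_PI2; ring).
rewrite Hm, sin_binsum; unfold binsum.
rewrite sum_even_odd; apply sum_eq; intros l Hl.
replace (2 * m + 1 - 2 * l)%nat with (2 * (m - l) + 1)%nat by lia.
replace (PI / 2 + INR (2 * l) * (PI / 2)) with (oddR l * (PI / 2))
  by (unfold oddR; rewrite mult_INR; simpl; field).
replace (PI / 2 + INR (2 * l + 1) * (PI / 2)) with (INR (S l) * PI)
  by (rewrite S_INR, plus_INR, mult_INR; simpl; field).
rewrite sin_nat_PI, sin_odd_PI2; ring.
Qed.

(** Gamma (n + 1/2) / Gamma (1/2). *)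
Fixpoint halfprod (n : nat) : R :=
  match n with O => 1 | S n' => halfprod n' * (INR n' + 1 / 2) end.

Lemma halfprod_pos n : 0 < halfprod n.
Proof.
induction n as [|n IH]; simpl; [lra|].
apply Rmult_lt_0_compat; [exact IH|pose proof (pos_INR n); lra].
Qed.

Lemma gbinom_half q k :
  gbinom (INR (q + k) - 1 / 2) k * (halfprod q * INR (fact k)) = halfprod (q + k).
Proof.
revert q; induction k as [|k IH]; intros q.
- simpl; rewrite Nat.add_0_r; ring.
- rewrite gbinom_S; replace (q + S k)%nat with (S q + k)%nat by lia.
  rewrite <- IH, (fact_simpl k), !mult_INR.
  replace (INR (S q + k) - 1 / 2 - INR k) with (INR q + 1 / 2)
    by (rewrite plus_INR, S_INR; field).
  simpl halfprod; field; apply INR_S_neq0.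
Qed.

Lemma fact_double n : INR (fact (2 * n)) = 4 ^ n * INR (fact n) * halfprod n.
Proof.
induction n as [|n IH]; [simpl; ring|].
replace (2 * S n)%nat with (S (S (2 * n))) by lia.
rewrite !fact_simpl, !mult_INR, IH, !S_INR, mult_INR; simpl; field.
Qed.

(** Comparison of coefficients of sin^(2s+1) cos^(2(i-s)+3): on the left those of
omega sin(omega x) cos x - cos(omega x) sin x from de Moivre's formula, on the
right those of the explicit Jacobi sum.  With r = i - s, both sides are
expressed through factorials and [halfprod]. *)
Lemma jacobi_coef i s : (s <= i)%nat ->
  (omega i * gbinom (omega i) (2 * s + 1) - gbinom (omega i) (2 * s)) * halfprod (S i)
  = 2 * INR (fact (i + 2)) * (gbinom (INR i + 1 / 2) (i - s) * gbinom (INR i + 3 / 2) s).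
Proof.
intros Hs; set (r := (i - s)%nat); assert (Hi : i = (s + r)%nat) by (unfold r; lia).
clearbody r; subst i; clear Hs.
assert (Ho : omega (s + r) = INR (2 * s + 2 * r + 3))
  by (unfold omega; rewrite !plus_INR, !mult_INR; simpl; ring).
pose proof (gbinom_nat_fact (2 * r + 2) (2 * s + 1)) as H1.
pose proof (gbinom_nat_fact (2 * r + 3) (2 * s)) as H2.
pose proof (gbinom_half (S s) r) as H3.
pose proof (gbinom_half (S (S r)) s) as H4.
replace (2 * r + 2 + (2 * s + 1))%nat with (2 * s + 2 * r + 3)%nat in H1 by lia.
replace (2 * r + 3 + 2 * s)%nat with (2 * s + 2 * r + 3)%nat in H2 by lia.
rewrite <- Ho in H1, H2.
replace (INR (S s + r) - 1 / 2) with (INR (s + r) + 1 / 2) in H3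
  by (rewrite !plus_INR, !S_INR; field).
replace (INR (S (S r) + s) - 1 / 2) with (INR (s + r) + 3 / 2) in H4
  by (rewrite !plus_INR, !S_INR; field).
replace (S s + r)%nat with (S (s + r)) in H3 by lia.
replace (S (S r) + s)%nat with (S (S (s + r))) in H4 by lia.
replace (s + r + 2)%nat with (S (S (s + r))) by lia.
assert (F1 : INR (fact (2 * r + 2)) = 4 ^ S r * INR (fact (S r)) * halfprod (S r)).
{ rewrite <- fact_double; do 2 f_equal; lia. }
assert (F2 : INR (fact (2 * r + 3)) = (2 * INR r + 3) * INR (fact (2 * r + 2))).
{ replace (2 * r + 3)%nat with (S (2 * r + 2)) by lia.
  rewrite fact_simpl, mult_INR; f_equal. rewrite S_INR, plus_INR, mult_INR; simpl; ring. }
assert (F3 : INR (fact (2 * s + 1)) = (2 * INR s + 1) * INR (fact (2 * s))).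
{ replace (2 * s + 1)%nat with (S (2 * s)) by lia.
  rewrite fact_simpl, mult_INR; f_equal. rewrite S_INR, mult_INR; simpl; ring. }
pose proof (fact_double s) as F4.
assert (F5 : (2 * INR (s + r) + 4) * INR (fact (2 * s + 2 * r + 3))
   = 4 ^ S (S (s + r)) * INR (fact (S (S (s + r)))) * halfprod (S (S (s + r)))).
{ rewrite <- fact_double; replace (2 * S (S (s + r)))%nat with (S (2 * s + 2 * r + 3)) by lia.
  rewrite (fact_simpl (2 * s + 2 * r + 3)), mult_INR; f_equal.
  rewrite S_INR, !plus_INR, !mult_INR; simpl; ring. }
rewrite F3 in H1. rewrite F2 in H2.
pose proof (INR_fact_lt_0 (2 * s)) as P1. pose proof (INR_fact_lt_0 (2 * r + 2)) as P2.
pose proof (INR_fact_lt_0 s) as P3. pose proof (INR_fact_lt_0 r) as P4.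
pose proof (pos_INR s) as P5. pose proof (pos_INR r) as P6.
pose proof (halfprod_pos (S s)) as P7. pose proof (halfprod_pos (S (S r))) as P8.
pose proof (halfprod_pos s) as P9. pose proof (halfprod_pos (S r)) as P10.
set (g1 := gbinom (omega (s + r)) (2 * s + 1)) in *.
set (g2 := gbinom (omega (s + r)) (2 * s)) in *.
set (g3 := gbinom (INR (s + r) + 1 / 2) r) in *.
set (g4 := gbinom (INR (s + r) + 3 / 2) s) in *.
assert (E1 : g1 = INR (fact (2 * s + 2 * r + 3)) / (INR (fact (2 * r + 2)) * ((2 * INR s + 1) * INR (fact (2 * s)))))
  by (rewrite <- H1; field; repeat split; lra).
assert (E2 : g2 = INR (fact (2 * s + 2 * r + 3)) / ((2 * INR r + 3) * INR (fact (2 * r + 2)) * INR (fact (2 * s))))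
  by (rewrite <- H2; field; repeat split; lra).
assert (E3 : g3 = halfprod (S (s + r)) / (halfprod (S s) * INR (fact r)))
  by (rewrite <- H3; field; repeat split; lra).
assert (E4 : g4 = halfprod (S (S (s + r))) / (halfprod (S (S r)) * INR (fact s)))
  by (rewrite <- H4; field; repeat split; lra).
rewrite E1, E2, E3, E4.
assert (E5 : INR (fact (2 * s + 2 * r + 3)) = 4 ^ S (S (s + r)) * INR (fact (S (S (s + r)))) * halfprod (S (S (s + r))) / (2 * INR (s + r) + 4)).
{ rewrite <- F5; field; pose proof (pos_INR (s + r)); lra. }
rewrite E5, F1, F4.
rewrite (fact_simpl r), mult_INR.
set (A := INR (fact (S (S (s + r))))).
set (B := halfprod (S (S (s + r)))). set (B' := halfprod (S (s + r))).
change (halfprod (S s)) with (halfprod s * (INR s + 1 / 2)) in *.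
change (halfprod (S (S r))) with (halfprod (S r) * (INR (S r) + 1 / 2)) in *.
rewrite !S_INR in *; unfold omega; rewrite !plus_INR.
replace (4 ^ S (S (s + r))) with (16 * 4 ^ s * 4 ^ r) by (simpl; rewrite pow_add; ring).
replace (4 ^ S r) with (4 * 4 ^ r) by reflexivity.
pose proof (pow_lt 4 s ltac:(lra)). pose proof (pow_lt 4 r ltac:(lra)).
field; repeat split; lra.
Qed.

(** Both sides are expanded in powers of sin x and cos x.  The expansion of
[eigE] has one more term than that of the Jacobi polynomial, with coefficient
omega * 1 - omega = 0; this reflects the third order zero at pi/2. *)
Lemma jacobi_eigE i x :
  INR (fact (i + 2)) * 2 * (cos x ^ 3 * jacobi (1 / 2) (3 / 2) i (cos (2 * x))) * sin x
  = halfprod (S i) * (sin x * eigE i x).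
Proof.
unfold eigE.
replace (sin x * (omega i * (cos x * sinq (S i) x) - cos (omega i * x)))
  with (omega i * cos x * (sin x * sinq (S i) x) - sin x * cos (omega i * x)) by ring.
rewrite sinq_spec, <- omega_oddR.
rewrite omega_oddR, sin_odd_binsum, cos_odd_binsum, <- omega_oddR.
rewrite !tech5.
assert (Htop : omega i * gbinom (omega i) (2 * S i + 1) = gbinom (omega i) (2 * S i)).
{ pose proof (gbinom_nat_fact 0 (2 * S i + 1)) as H1.
  pose proof (gbinom_nat_fact 1 (2 * S i)) as H2.
  rewrite Nat.add_0_l in H1. replace (1 + 2 * S i)%nat with (2 * S i + 1)%nat in H2 by lia.
  assert (Ho : INR (2 * S i + 1) = omega i)
    by (rewrite omega_oddR, oddR_INR; reflexivity).
  rewrite Ho in H1, H2.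
  replace (fact (2 * S i + 1)) with ((2 * S i + 1) * fact (2 * S i))%nat in H1, H2.
  2:{ replace (2 * S i + 1)%nat with (S (2 * S i)) by lia; reflexivity. }
  rewrite mult_INR, Ho in H1, H2.
  pose proof (INR_fact_lt_0 (2 * S i)) as P. pose proof (omega_ge3 i).
  change (fact 0) with 1%nat in H1; change (fact 1) with 1%nat in H2.
  change (INR 1) with 1 in H1, H2.
  apply (Rmult_eq_reg_r (INR (fact (2 * S i)))); [|lra]. 
  assert (gbinom (omega i) (2 * S i + 1) = 1).
  { apply (Rmult_eq_reg_r (omega i * INR (fact (2 * S i)))); [lra|]. apply Rmult_integral_contrapositive; lra. }
  lra. }
unfold jacobi; rewrite sum_n_Reals.
match goal with |- ?A * 2 * (?c * ?S0) * ?d = ?h * (?w * (?S1 + ?t1) - ?d * (?S2 + ?t2)) =>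
  replace (A * 2 * (c * S0) * d) with ((2 * A * c * d) * S0) by ring;
  replace (h * (w * (S1 + t1) - d * (S2 + t2)))
    with (h * (w * S1 - d * S2 + (w * t1 - d * t2))) by ring;
  assert (Ht : w * t1 - d * t2 = 0)
end.
{ rewrite Nat.sub_diag, Nat.mul_0_r, Nat.add_0_l, pow_O, pow_1, pow_add, pow_1, <- Htop; ring. }
rewrite Ht, Rplus_0_r, !scal_sum, <- minus_sum, scal_sum.
apply sum_eq; intros s Hs.
replace ((cos (2 * x) - 1) / 2) with (- (sin x ^ 2))
  by (rewrite cos_2a_sin; field).
replace ((cos (2 * x) + 1) / 2) with (cos x ^ 2)
  by (rewrite cos_2a_cos; field).
pose proof (jacobi_coef i s Hs) as H.
replace (S i - s)%nat with (i - s + 1)%nat by lia.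
replace ((- sin x ^ 2) ^ s) with ((-1) ^ s * sin x ^ (2 * s))
  by (rewrite pow_mult, <- Rpow_mult_distr; f_equal; ring).
rewrite <- pow_mult.
replace (2 * (i - s + 1))%nat with (2 * (i - s) + 2)%nat by lia.
rewrite !pow_add; simpl (_ ^ 1); simpl (cos x ^ 2); simpl (cos x ^ 3).
set (cc := cos x ^ (2 * (i - s))); set (ss := sin x ^ (2 * s)).
transitivity (2 * INR (fact (i + 2)) * (gbinom (INR i + 1 / 2) (i - s) * gbinom (INR i + 3 / 2) s)
  * ((-1) ^ s * ss * cc * sin x * (cos x ^ 3))); [simpl; ring|].
rewrite <- H; ring.
Qed.

(** * The Gamma function at half-integers and the normalisation *)

Lemma continuous_Rpower_exp y t : 0 < t ->
  continuous (fun t => Rpower t y * exp (- t)) t.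
Proof.
intros Ht; apply (ex_derive_continuous (fun t => Rpower t y * exp (- t))).
unfold Rpower; auto_derive; exact Ht.
Qed.

(** Improper integrals over (0, infinity) only depend on intervals [a, b] with
0 < a < 1 < b. *)
Lemma filter_prod_pos (P : R * R -> Prop) :
  (forall a b, 0 < a < 1 -> 1 < b -> P (a, b)) ->
  filter_prod (at_right 0) (Rbar_locally p_infty) P.
Proof.
intros H.
apply (Filter_prod _ _ _ (fun a => 0 < a < 1) (fun b => 1 < b)).
- exists (mkposreal 1 Rlt_0_1); intros y Hy Hy0.
  unfold ball in Hy; simpl in Hy; unfold AbsRing_ball, abs, minus, plus, opp in Hy; simpl in Hy.
  apply Rabs_def2 in Hy; lra.
- exists 1; trivial.
- intros; apply H; assumption.
Qed.

(** The integrand sqrt t * exp (- t) is continuous on the whole line, so the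
lower limit causes no problem; the primitive is nondecreasing and bounded, since
sqrt t <= exp (t/2). *)
Lemma ex_Gamma_3_2 :
  ex_RInt_gen (fun t => Rpower t (3 / 2 - 1) * exp (- t)) (at_right 0) (Rbar_locally p_infty).
Proof.
set (f := fun t => sqrt t * exp (- t)).
assert (Hf : forall t, continuous f t).
{ intros t; apply continuous_Rmult; [apply continuous_sqrt|].
  apply (ex_derive_continuous (fun t => exp (- t))); auto_derive; trivial. }
set (F := (fun b => RInt f 0 b) : R -> R).
assert (HF : forall a b, is_RInt f a b (F b - F a)).
{ intros a b; unfold F; rewrite <- (RInt_Chasles f 0 a b) by (apply ex_RInt_cont, Hf).
  replace (plus (RInt f 0 a) (RInt f a b) - RInt f 0 a) with (RInt f a b)
    by (unfold plus; simpl; unfold Rminus; rewrite Rplus_comm, <- Rplus_assoc, Rplus_opp_l, Rplus_0_l; reflexivity).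
  apply (RInt_correct f), ex_RInt_cont, Hf. }
assert (Hmono : forall a b, a <= b -> F a <= F b).
{ intros a b Hab. enough (0 <= F b - F a) by lra.
  apply (is_RInt_ge_0 f a b); [exact Hab|apply HF|].
  intros x _; apply Rmult_le_pos; [apply sqrt_pos|left; apply exp_pos]. }
assert (Hub : forall b, 0 <= b -> F b <= 2).
{ intros b Hb.
  assert (HI : is_RInt (fun t => exp (- t / 2)) 0 b (- 2 * exp (- b / 2) - - 2 * exp (- 0 / 2))).
  { apply (is_RInt_derive (fun t => - 2 * exp (- t / 2)) (fun t => exp (- t / 2))).
    - intros x _; auto_derive; [trivial|unfold Rdiv; field].
    - intros x _; apply (ex_derive_continuous (fun t => exp (- t / 2))); auto_derive; trivial. }
  apply Rle_trans with (- 2 * exp (- b / 2) - - 2 * exp (- 0 / 2)).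
  - apply (is_RInt_le f (fun t => exp (- t / 2)) 0 b); [exact Hb| |exact HI|].
    { replace (F b) with (F b - F 0); [apply HF|].
      unfold F at 2; rewrite RInt_point; unfold zero; simpl; ring. }
    intros x Hx; unfold f.
    replace (exp (- x / 2)) with (exp (x / 2) * exp (- x)) by (rewrite <- exp_plus; f_equal; field).
    apply Rmult_le_compat_r; [left; apply exp_pos|].
    rewrite <- (sqrt_Rsqr (exp (x / 2))) by (left; apply exp_pos).
    apply sqrt_le_1_alt; unfold Rsqr; rewrite <- exp_plus.
    replace (x / 2 + x / 2) with x by field. 
    pose proof (exp_ineq1_le x); lra.
  - pose proof (exp_pos (- b / 2)); replace (- 0 / 2) with 0 by field; rewrite exp_0; lra. }
destruct (completeness (fun y => exists b, 0 <= b /\ y = F b)) as [L [HL1 HL2]].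
- exists 2; intros y [b [Hb ->]]; apply Hub, Hb.
- exists (F 0), 0; split; [lra|reflexivity].
- assert (HlimF : filterlim F (Rbar_locally p_infty) (locally L)).
  { intros P [eps HP].
    assert (Hn : ~ is_upper_bound (fun y => exists b, 0 <= b /\ y = F b) (L - eps)).
    { intros H; apply HL2 in H; pose proof (cond_pos eps); lra. }
    assert (Hb : exists b, 0 <= b /\ L - eps < F b).
    { apply Classical_Prop.NNPP; intros Hno; apply Hn; intros y [b [Hb ->]].
      apply Rnot_lt_le; intros H; apply Hno; exists b; split; assumption. }
    destruct Hb as [b [Hb HLb]].
    exists b; intros t Ht; apply HP.
    unfold ball; simpl; unfold AbsRing_ball, abs, minus, plus, opp; simpl.
    assert (F t <= L) by (apply HL1; exists t; split; [lra|reflexivity]).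
    pose proof (Hmono b t ltac:(lra)). pose proof (cond_pos eps).
    apply Rabs_def1; lra. }
  exists (minus L (F 0)).
  apply (filterlimi_lim_ext_loc (fun ab => minus (F (snd ab)) (F (fst ab)))).
  + apply filter_prod_pos; intros a b Ha Hb; simpl.
    apply (is_RInt_ext f); [|apply HF].
    rewrite Rmin_left, Rmax_right by lra; intros x Hx; unfold f.
    replace (3 / 2 - 1) with (/ 2) by field; rewrite Rpower_sqrt by lra; reflexivity.
  + unfold minus.
    assert (HF0 : filterlim F (at_right 0) (locally (F 0))).
    { apply (filterlim_filter_le_1 F (filter_le_within _)).
      apply (ex_derive_continuous F 0); exists (f 0).
      apply (is_derive_RInt f F 0 0); [|apply Hf].
      apply filter_forall; intros y; unfold F; apply (RInt_correct f), ex_RInt_cont, Hf. }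
    apply (@filterlim_comp_2 _ _ _ _ _ (locally L) (locally (opp (F 0))) _ _
      (fun ab => F (snd ab)) (fun ab => opp (F (fst ab))) plus).
    * apply (filterlim_comp _ _ _ snd F _ (Rbar_locally p_infty)); [apply filterlim_snd|exact HlimF].
    * apply (filterlim_comp _ _ _ fst (fun a => opp (F a)) _ (at_right 0)); [apply filterlim_fst|].
      apply (filterlim_comp _ _ _ F opp _ (locally (F 0))); [exact HF0|apply (filterlim_opp (F 0))].
    * apply (filterlim_plus L (opp (F 0))).
Qed.

Lemma filterlim_Rpower_exp_0 y : 1 <= y ->
  filterlim (fun t => Rpower t y * exp (- t)) (at_right 0) (locally 0).
Proof.
intros Hy P [eps HP].
exists (mkposreal _ (Rmin_pos 1 eps Rlt_0_1 (cond_pos eps))); intros t Ht Ht0; apply HP.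
unfold ball in *; simpl in *; unfold AbsRing_ball, abs, minus, plus, opp in *; simpl in *.
pose proof (Rmin_l 1 eps); pose proof (Rmin_r 1 eps); apply Rabs_def2 in Ht.
assert (Rpower t y <= t).
{ rewrite <- (Rpower_1 t) at 2 by exact Ht0. unfold Rpower.
  assert (ln t <= 0) by (rewrite <- ln_1; apply Rcomplements.ln_le; lra).
  assert (y * ln t <= 1 * ln t) by nra.
  destruct H2 as [H2| ->]; [left; apply exp_increasing; exact H2|right; reflexivity]. }
assert (0 < Rpower t y) by apply exp_pos.
assert (0 < exp (- t) <= 1).
{ split; [apply exp_pos|]. rewrite <- exp_0; left; apply exp_increasing; lra. }
rewrite Ropp_0, Rplus_0_r, Rabs_pos_eq by nra. nra.
Qed.

(** exp t >= (t/n)^n bounds t^y exp (- t) by n^n / t. *)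
Lemma filterlim_Rpower_exp_infty n y : 0 <= y -> y + 1 <= INR n ->
  filterlim (fun t => Rpower t y * exp (- t)) (Rbar_locally p_infty) (locally 0).
Proof.
intros Hy0 Hy P [eps HP].
assert (Hn : 0 < INR n) by lra.
exists (Rmax 1 (INR n ^ n / eps)); intros t Ht; apply HP.
unfold ball; simpl; unfold AbsRing_ball, abs, minus, plus, opp; simpl.
pose proof (Rmax_l 1 (INR n ^ n / eps)); pose proof (Rmax_r 1 (INR n ^ n / eps)).
assert (H1 : Rpower t y * t <= t ^ n).
{ rewrite <- (Rpower_1 t) at 2 by lra; rewrite <- Rpower_plus, <- Rpower_pow by lra.
  apply Rle_Rpower; lra. }
assert (H2 : t ^ n * exp (- t) <= INR n ^ n).
{ apply (Rmult_le_reg_r (exp t)); [apply exp_pos|].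
  rewrite Rmult_assoc, <- exp_plus, Rplus_opp_l, exp_0, Rmult_1_r.
  replace (exp t) with (exp (t / INR n) ^ n).
  2:{ rewrite <- Rpower_pow by apply exp_pos; unfold Rpower at 1; rewrite ln_exp; f_equal; field; lra. }
  rewrite <- Rpow_mult_distr; apply pow_incr; split; [lra|].
  pose proof (exp_ineq1_le (t / INR n)).
  replace t with (INR n * (t / INR n)) at 1 by (field; lra).
  apply Rmult_le_compat_l; lra. }
assert (0 < Rpower t y) by apply exp_pos. pose proof (exp_pos (- t)).
rewrite Ropp_0, Rplus_0_r, Rabs_pos_eq by nra.
pose proof (cond_pos eps).
assert (H6 : INR n ^ n < t * eps).
{ replace (INR n ^ n) with (INR n ^ n / eps * eps) by (field; lra).
  apply Rmult_lt_compat_r; lra. }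
apply (Rmult_lt_reg_r t); [lra|].
apply Rle_lt_trans with (t ^ n * exp (- t)); [|lra].
replace (Rpower t y * exp (- t) * t) with (Rpower t y * t * exp (- t)) by ring.
apply Rmult_le_compat_r; lra.
Qed.

(** The derivative of t^y exp (- t) is y times the one integrand minus the
other, and t^y exp (- t) vanishes at both ends. *)
Lemma is_Gamma_succ y l : 1 <= y ->
  is_RInt_gen (fun t => Rpower t (y - 1) * exp (- t)) (at_right 0) (Rbar_locally p_infty) l ->
  is_RInt_gen (fun t => Rpower t (y + 1 - 1) * exp (- t)) (at_right 0) (Rbar_locally p_infty) (y * l).
Proof.
intros Hy Hl.
set (g := fun t => Rpower t y * exp (- t)).
assert (Hdg : forall t, 0 < t -> is_derive g t (y * (Rpower t (y - 1) * exp (- t)) - g t)).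
{ intros t Ht; unfold g, Rpower; auto_derive; [exact Ht|].
  replace ((y - 1) * ln t) with (y * ln t + - ln t) by ring.
  rewrite exp_plus, (exp_Ropp (ln t)), exp_ln by exact Ht; field; lra. }
assert (Hn : exists n, y + 1 <= INR n).
{ destruct (INR_unbounded (y + 1)) as [n Hn]; exists n; lra. }
destruct Hn as [n Hn].
assert (Hg : is_RInt_gen (Derive g) (at_right 0) (Rbar_locally p_infty) (0 - 0)).
{ apply (is_RInt_gen_Derive g).
  - apply filter_prod_pos; intros a b Ha Hb x; simpl.
    rewrite Rmin_left by lra; intros Hx.
    eexists; apply Hdg; lra.
  - apply filter_prod_pos; intros a b Ha Hb x; simpl.
    rewrite Rmin_left by lra; intros Hx.
    assert (Hx0 : 0 < x) by lra.
    apply (continuous_ext_loc _ (fun t => y * (Rpower t (y - 1) * exp (- t)) - g t)).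
    + exists (mkposreal x Hx0); intros t Ht; symmetry; apply is_derive_unique, Hdg.
      unfold ball in Ht; simpl in Ht; unfold AbsRing_ball, abs, minus, plus, opp in Ht; simpl in Ht.
      apply Rabs_def2 in Ht; lra.
    + apply continuous_Rminus; [apply continuous_Rmult; [apply continuous_const|]|];
        apply continuous_Rpower_exp, Hx0.
  - apply filterlim_Rpower_exp_0, Hy.
  - apply (filterlim_Rpower_exp_infty n); lra. }
replace (y * l) with (minus (scal y l) (0 - 0))
  by (unfold minus, plus, opp, scal; simpl; unfold mult; simpl; ring).
apply (is_RInt_gen_ext (fun t => minus (scal y (Rpower t (y - 1) * exp (- t))) (Derive g t))).
- apply filter_prod_pos; intros a b Ha Hb x; simpl.
  rewrite Rmin_left by lra; intros Hx.
  rewrite (is_derive_unique _ _ _ (Hdg x ltac:(lra))).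
  unfold g; replace (y + 1 - 1) with y by ring.
  unfold minus, plus, opp, scal; simpl; unfold mult; simpl; ring.
- apply (is_RInt_gen_minus (fun t => scal y (Rpower t (y - 1) * exp (- t))) (Derive g)
    (scal y l) (0 - 0)); [|exact Hg].
  apply (is_RInt_gen_scal (fun t => Rpower t (y - 1) * exp (- t)) y l Hl).
Qed.

Lemma is_Gamma_half i :
  is_RInt_gen (fun t => Rpower t (INR i + 3 / 2 - 1) * exp (- t))
    (at_right 0) (Rbar_locally p_infty) (2 * halfprod (S i) * Gamma (3 / 2)).
Proof.
induction i as [|i IH].
- replace (2 * halfprod 1 * Gamma (3 / 2)) with (Gamma (3 / 2)) by (simpl; field).
  replace (INR 0 + 3 / 2) with (3 / 2) by (simpl; ring).
  exact (RInt_gen_correct (V := R_CompleteNormedModule) _ ex_Gamma_3_2).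
- rewrite S_INR.
  replace (INR i + 1 + 3 / 2) with ((INR i + 3 / 2) + 1) by ring.
  replace (2 * halfprod (S (S i)) * Gamma (3 / 2))
    with ((INR i + 3 / 2) * (2 * halfprod (S i) * Gamma (3 / 2))).
  2:{ change (halfprod (S (S i))) with (halfprod (S i) * (INR (S i) + 1 / 2)); rewrite S_INR; field. }
  apply is_Gamma_succ; [pose proof (pos_INR i); lra|exact IH].
Qed.

Lemma Gamma_half i : Gamma (INR i + 3 / 2) = 2 * halfprod (S i) * Gamma (3 / 2).
Proof. unfold Gamma at 1; exact (is_RInt_gen_unique _ _ (is_Gamma_half i)). Qed.

(** The number c_i with e_i = c_i E_i.  Gamma (3/2) enters as one factor common to
all eigenfunctions, and its inverse is part of the implied constants. *)
Definition normc (i : nat) : R :=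
  sqrt (INR (fact i) * INR (fact (i + 2))) / INR (fact (i + 2)) * (/ Gamma (3 / 2) / 2).

Lemma e_eigE i x : sin x <> 0 -> e i x = normc i * eigE i x.
Proof.
intros Hx; unfold e, normc; rewrite Gamma_half.
assert (Hj := jacobi_eigE i x).
pose proof (halfprod_pos (S i)). pose proof (INR_fact_lt_0 (i + 2)).
assert (Hc : cos x ^ 3 * jacobi (1 / 2) (3 / 2) i (cos (2 * x))
   = halfprod (S i) * eigE i x / (2 * INR (fact (i + 2)))).
{ apply (Rmult_eq_reg_r (sin x)); [|exact Hx].
  apply (Rmult_eq_reg_l (INR (fact (i + 2)) * 2)); [|lra].
  rewrite <- Rmult_assoc, Hj; field; lra. }
rewrite Rmult_assoc, Hc; unfold Rdiv; rewrite !Rinv_mult.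
set (G := / Gamma _). field. lra.
Qed.

Lemma normc_bound i : Rabs (normc i) * omega i <= 3 * Rabs (/ Gamma (3 / 2) / 2).
Proof.
unfold normc; rewrite Rabs_mult.
enough (Rabs (sqrt (INR (fact i) * INR (fact (i + 2))) / INR (fact (i + 2))) * omega i <= 3).
{ pose proof (Rabs_pos (/ Gamma (3 / 2) / 2)). nra. }
pose proof (INR_fact_lt_0 (i + 2)) as P. pose proof (INR_fact_lt_0 i) as P'.
pose proof (omega_ge3 i) as Po.
rewrite Rabs_pos_eq.
2:{ apply Rdiv_le_0_compat; [apply sqrt_pos|exact P]. }
apply (Rmult_le_reg_r (INR (fact (i + 2)))); [exact P|].
match goal with |- ?q / ?f * ?w * ?f <= _ => replace (q / f * w * f) with (w * q) by (field; lra) end.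
apply Rsqr_incr_0_var; [|lra].
rewrite !Rsqr_mult, Rsqr_sqrt by nra.
replace (i + 2)%nat with (S (S i)) in * by lia.
rewrite !fact_simpl, !mult_INR in *. unfold omega in *; rewrite !S_INR in *.
pose proof (pos_INR i); unfold Rsqr. set (f := INR (fact i)) in *. set (t := INR i) in *.
apply Rminus_le.
match goal with |- ?d <= 0 => replace d with
  (- ((t + 1 + 1) * (t + 1) * (f * f) * (5 * t * t + 15 * t + 9))) by ring end.
assert (0 < f * f) by nra. assert (0 < (t + 1 + 1) * (t + 1)) by nra.
assert (0 <= 5 * t * t + 15 * t + 9) by nra.
assert (0 < (t + 1 + 1) * (t + 1) * (f * f)) by nra. nra.
Qed.

(** * Smooth factors of the integrands *)

Lemma sin_cos_pos x : 0 < x < PI / 2 -> 0 < sin x /\ 0 < cos x.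
Proof. intros Hx; split; [apply sin_gt_0|apply cos_gt_0]; lra. Qed.

Lemma eigE_quot k x : sin x <> 0 ->
  eigE k x = omega k * (cos x * sin (omega k * x) / sin x) - cos (omega k * x).
Proof.
intros Hx; unfold eigE; replace (sin (omega k * x)) with (sin x * sinq (S k) x)
  by (rewrite omega_oddR; apply sinq_spec); field; exact Hx.
Qed.

Lemma eigF_quot k x : cos x <> 0 ->
  eigF k x = omega k * sin (omega k * x) - sin x * cos (omega k * x) / cos x.
Proof.
intros Hx; unfold eigF; replace (cos (omega k * x)) with (cos x * cosq (S k) x)
  by (rewrite omega_oddR; apply cosq_spec); field; exact Hx.
Qed.

Lemma eigD_quot k x : sin x <> 0 ->
  eigD k x = omega k * cos (omega k * x) - cos x * sin (omega k * x) / sin x.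
Proof.
intros Hx; unfold eigD; replace (sin (omega k * x)) with (sin x * sinq (S k) x)
  by (rewrite omega_oddR; apply sinq_spec); field; exact Hx.
Qed.

Lemma eigF_tan k x : 0 < x < PI / 2 -> eigF k x = tan x * eigE k x.
Proof.
intros Hx; apply sin_cos_pos in Hx.
rewrite eigF_quot, eigE_quot by lra; unfold tan; field; lra.
Qed.

Lemma locally_Ioo (a b x : R) (P : R -> Prop) :
  a < x < b -> (forall y, a < y < b -> P y) -> locally x P.
Proof.
intros Hx HP; exists (mkposreal _ (Rmin_pos (x - a) (b - x) ltac:(lra) ltac:(lra))).
intros y Hy; apply HP.
unfold ball in Hy; simpl in Hy; unfold AbsRing_ball, abs, minus, plus, opp in Hy; simpl in Hy.
pose proof (Rmin_l (x - a) (b - x)); pose proof (Rmin_r (x - a) (b - x)).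
apply Rabs_def2 in Hy; lra.
Qed.

(** The three derivatives below are expressed through E, F, D and tan x again,
so that products of them can be differentiated without expanding. *)
Lemma is_derive_eigE k x : 0 < x < PI / 2 ->
  is_derive (eigE k) x (omega k * eigD k x / tan x).
Proof.
intros Hx; destruct (sin_cos_pos x Hx) as [Hs Hc].
apply (is_derive_ext_loc
  (fun x => omega k * (cos x * sin (omega k * x) / sin x) - cos (omega k * x))).
- apply (locally_Ioo 0 (PI / 2)); [exact Hx|]; intros y Hy; symmetry; apply eigE_quot.
  apply sin_cos_pos in Hy; lra.
- rewrite eigD_quot by lra; auto_derive; [lra|].
  pose proof (sin2_cos2 x) as H; unfold Rsqr in H.
  unfold tan; field_simplify_eq; [|lra].
  replace (cos x ^ 2) with (1 - sin x ^ 2) by lra. ring.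
Qed.

Lemma is_derive_eigF k x : 0 < x < PI / 2 ->
  is_derive (eigF k) x ((1 + tan x ^ 2) * eigE k x + omega k * eigD k x).
Proof.
intros Hx; destruct (sin_cos_pos x Hx) as [Hs Hc].
apply (is_derive_ext_loc (fun x => tan x * eigE k x)).
- apply (locally_Ioo 0 (PI / 2)); [exact Hx|]; intros y Hy; symmetry; apply eigF_tan, Hy.
- replace (omega k * eigD k x) with (tan x * (omega k * eigD k x / tan x)).
  2:{ unfold tan; field; lra. }
  apply (is_derive_mult tan (eigE k)); [|apply is_derive_eigE, Hx|intros; apply Rmult_comm].
  replace (1 + tan x ^ 2) with (tan x ^ 2 + 1) by ring; apply is_derive_tan; lra.
Qed.

Lemma is_derive_eigD k x : 0 < x < PI / 2 ->
  is_derive (eigD k) x (- omega k * eigF k x - (1 + tan x ^ 2) * eigD k x / tan x).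
Proof.
intros Hx; destruct (sin_cos_pos x Hx) as [Hs Hc].
apply (is_derive_ext_loc
  (fun x => omega k * cos (omega k * x) - cos x * sin (omega k * x) / sin x)).
- apply (locally_Ioo 0 (PI / 2)); [exact Hx|]; intros y Hy; symmetry; apply eigD_quot.
  apply sin_cos_pos in Hy; lra.
- rewrite eigD_quot, eigF_quot by lra; auto_derive; [lra|].
  pose proof (sin2_cos2 x) as H; unfold Rsqr in H.
  replace (1 + tan x ^ 2) with (1 / cos x ^ 2).
  2:{ unfold tan; field_simplify_eq; [|lra]; lra. }
  unfold tan; field_simplify_eq; [|lra].
  replace (sin x ^ 3) with (sin x * sin x ^ 2) by ring.
  replace (sin x ^ 2) with (1 - cos x ^ 2) by lra. ring.
Qed.

Lemma continuous_eigE k x : continuous (eigE k) x.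
Proof. unfold eigE; cont. Qed.
Lemma continuous_eigF k x : continuous (eigF k) x.
Proof. unfold eigF; cont. Qed.
Lemma continuous_eigD k x : continuous (eigD k) x.
Proof. unfold eigD; cont. Qed.

Ltac conteig :=
  repeat lazymatch goal with
    | |- continuous (fun y => ?f * ?g) _ =>
        apply (continuous_Rmult (fun y => f) (fun y => g))
    | |- continuous (fun y => eigE _ y) _ => apply continuous_eigE
    | |- continuous (fun y => eigF _ y) _ => apply continuous_eigF
    | |- continuous (fun y => eigD _ y) _ => apply continuous_eigD
    | |- _ => progress cont
  end.

Lemma G_eig j k i :
  G j k i = (normc i * normc j * normc k)
            * RInt (fun x => eigF i x * (eigF j x * eigE k x)) 0 (PI / 2).
Proof.
unfold G.
rewrite <- (RInt_scal (V := R_CompleteNormedModule)) by (apply ex_RInt_cont; intros; conteig).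
apply RInt_ext; rewrite Rmin_left, Rmax_right by (pose proof PI_RGT_0; lra).
intros x Hx; rewrite !eigF_tan by exact Hx.
apply sin_cos_pos in Hx; rewrite !e_eigE by lra.
unfold scal; simpl; unfold mult; simpl; ring.
Qed.

Lemma H0_eig j k i :
  H0 j k i = (normc 0 * normc i * normc j * normc k)
            * RInt (fun x => eigE 0 x * (eigF i x * (eigF j x * eigE k x))) 0 (PI / 2).
Proof.
unfold H0.
rewrite <- (RInt_scal (V := R_CompleteNormedModule)) by (apply ex_RInt_cont; intros; conteig).
apply RInt_ext; rewrite Rmin_left, Rmax_right by (pose proof PI_RGT_0; lra).
intros x Hx; rewrite !eigF_tan by exact Hx.
apply sin_cos_pos in Hx; rewrite !e_eigE by lra.
unfold scal; simpl; unfold mult; simpl; ring.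
Qed.

Lemma Derive_e k x : 0 < x < PI / 2 ->
  Derive (e k) x / omega k * tan x = normc k * eigD k x.
Proof.
intros Hx; rewrite (is_derive_unique _ _ (normc k * (omega k * eigD k x / tan x))).
- destruct (sin_cos_pos x Hx); pose proof (omega_ge3 k); unfold tan; field; lra.
- apply (is_derive_ext_loc (fun x => normc k * eigE k x)).
  + apply (locally_Ioo 0 (PI / 2)); [exact Hx|]; intros y Hy; symmetry; apply e_eigE.
    apply sin_cos_pos in Hy; lra.
  + apply (is_derive_scal (eigE k)), is_derive_eigE, Hx.
Qed.

Lemma Gbar_eig j k i :
  Gbar j k i = (normc i * normc j * normc k)
            * RInt (fun x => eigD i x * (eigD j x * eigE k x)) 0 (PI / 2).
Proof.
unfold Gbar.
rewrite <- (RInt_scal (V := R_CompleteNormedModule)) by (apply ex_RInt_cont; intros; conteig).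
apply RInt_ext; rewrite Rmin_left, Rmax_right by (pose proof PI_RGT_0; lra).
intros x Hx.
replace (e k x * (Derive (e j) x / omega j) * (Derive (e i) x / omega i) * tan x ^ 2)
  with (e k x * (Derive (e j) x / omega j * tan x) * (Derive (e i) x / omega i * tan x)) by ring.
rewrite !Derive_e by exact Hx.
apply sin_cos_pos in Hx; rewrite !e_eigE by lra.
unfold scal; simpl; unfold mult; simpl; ring.
Qed.

(** * Growth estimates *)

Lemma Rabs_le_mult a b A B : Rabs a <= A -> Rabs b <= B -> Rabs (a * b) <= A * B.
Proof. intros; rewrite Rabs_mult; apply Rmult_le_compat; auto using Rabs_pos. Qed.

Lemma Rabs_le_minus a b A B : Rabs a <= A -> Rabs b <= B -> Rabs (a - b) <= A + B.
Proof.
intros; eapply Rle_trans; [apply Rabs_triang|]; rewrite Rabs_Ropp; lra.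
Qed.

Lemma eigF_bound k x : Rabs (eigF k x) <= 2 * omega k.
Proof.
replace (2 * omega k) with (omega k * 1 + 1 * omega k) by ring.
apply Rabs_le_minus; apply Rabs_le_mult; try apply abs_sin_le1.
- rewrite Rabs_pos_eq; [lra|pose proof (omega_ge3 k); lra].
- rewrite omega_oddR; apply cosq_bound.
Qed.

Lemma eigD_bound k x : Rabs (eigD k x) <= 2 * omega k.
Proof.
replace (2 * omega k) with (omega k * 1 + 1 * omega k) by ring.
apply Rabs_le_minus; apply Rabs_le_mult; try apply abs_cos_le1.
- rewrite Rabs_pos_eq; [lra|pose proof (omega_ge3 k); lra].
- rewrite omega_oddR; apply sinq_bound.
Qed.

Lemma eigE_bound k x : Rabs (eigE k x) <= 2 * omega k ^ 2.
Proof.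
pose proof (omega_ge3 k).
apply Rle_trans with (omega k * (1 * omega k) + 1); [|nra].
apply Rabs_le_minus; [|apply abs_cos_le1].
apply Rabs_le_mult; [rewrite Rabs_pos_eq; lra|].
apply Rabs_le_mult; [apply abs_cos_le1|rewrite omega_oddR; apply sinq_bound].
Qed.

Lemma abs_RInt_PI2 (f : R -> R) M :
  (forall x, continuous f x) -> (forall x, Rabs (f x) <= M) ->
  Rabs (RInt f 0 (PI / 2)) <= 2 * M.
Proof.
intros Hc HM. pose proof PI_RGT_0; pose proof PI_4.
apply Rle_trans with ((PI / 2 - 0) * M).
- apply abs_RInt_le_const; [lra|apply ex_RInt_cont, Hc|intros; apply HM].
- assert (0 <= M) by (eapply Rle_trans; [apply Rabs_pos|apply (HM 0)]). 
  apply Rmult_le_compat_r; lra.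
Qed.

(** Each normalisation constant is O(1/omega), so that an integral over three
eigenfunctions may be divided by the product of their frequencies. *)
Lemma normc_product_bound : exists K, 0 <= K /\ forall i j k T B, 0 <= B ->
  Rabs T <= B * (omega i * omega j * omega k) ->
  Rabs (normc i * normc j * normc k * T) <= K * B.
Proof.
set (q := 3 * Rabs (/ Gamma (3 / 2) / 2)).
exists (q * q * q).
assert (Hq : 0 <= q) by (unfold q; pose proof (Rabs_pos (/ Gamma (3 / 2) / 2)); lra).
split; [apply Rmult_le_pos; nra|]; intros i j k T B HB HT.
rewrite !Rabs_mult.
apply Rle_trans with (Rabs (normc i) * Rabs (normc j) * Rabs (normc k) * (B * (omega i * omega j * omega k))).
{ apply Rmult_le_compat_l; [|exact HT].
  repeat apply Rmult_le_pos; apply Rabs_pos. }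
replace (Rabs (normc i) * Rabs (normc j) * Rabs (normc k) * (B * (omega i * omega j * omega k)))
  with ((Rabs (normc i) * omega i) * (Rabs (normc j) * omega j) * (Rabs (normc k) * omega k) * B) by ring.
assert (Hn : forall l, 0 <= Rabs (normc l) * omega l <= q).
{ intros l; split; [|apply normc_bound].
  apply Rmult_le_pos; [apply Rabs_pos|pose proof (omega_ge3 l); lra]. }
apply Rmult_le_compat_r; [exact HB|].
destruct (Hn i), (Hn j), (Hn k).
apply Rmult_le_compat; [apply Rmult_le_pos; assumption|assumption| |assumption].
apply Rmult_le_compat; assumption.
Qed.

(** The integrals of F_i F_j E_k and D_i D_j E_k are at most
2 * (2 omega_i) (2 omega_j) (2 omega_k^2), with 2 a bound for the length of the
interval; E_0 is bounded by 18. *)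
Lemma growth_bounds : exists K, forall i j k,
  Rabs (H0 j k i) <= K * omega k /\ Rabs (G j k i) <= K * omega k
  /\ Rabs (Gbar j k i) <= K * omega k.
Proof.
destruct normc_product_bound as [K [HK HB]].
exists (16 * K + 288 * K * Rabs (normc 0)); intros i j k.
pose proof (omega_ge3 i); pose proof (omega_ge3 j); pose proof (omega_ge3 k).
assert (Hgen : forall (f : R -> R) M, 0 <= M -> (forall x, continuous f x) ->
  (forall x, Rabs (f x) <= M * (2 * omega i * (2 * omega j * (2 * omega k ^ 2)))) ->
  Rabs (normc i * normc j * normc k * RInt f 0 (PI / 2)) <= 16 * K * M * omega k).
{ intros f M HM Hc Hf.
  replace (16 * K * M * omega k) with (K * (16 * M * omega k)) by ring.
  apply HB; [apply Rmult_le_pos; lra|].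
  eapply Rle_trans; [apply abs_RInt_PI2; [exact Hc|exact Hf]|].
  right; ring. }
assert (HKn : 0 <= 288 * K * Rabs (normc 0)) by (pose proof (Rabs_pos (normc 0)); apply Rmult_le_pos; lra).
assert (H16 : 16 * K * 1 * omega k <= (16 * K + 288 * K * Rabs (normc 0)) * omega k).
{ apply Rmult_le_compat_r; lra. }
split; [|split].
- rewrite H0_eig.
  replace (normc 0 * normc i * normc j * normc k) with (normc 0 * (normc i * normc j * normc k)) by ring.
  rewrite (Rmult_assoc (normc 0)), Rabs_mult.
  apply Rle_trans with (Rabs (normc 0) * (16 * K * 18 * omega k)).
  + apply Rmult_le_compat_l; [apply Rabs_pos|].
    apply Hgen; [lra|intros; conteig|].
    intros x; repeat apply Rabs_le_mult; try apply eigF_bound; try apply eigE_bound.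
    eapply Rle_trans; [apply eigE_bound|]; unfold omega; simpl; lra.
  + assert (0 <= 16 * K * omega k) by (apply Rmult_le_pos; lra). lra.
- rewrite G_eig; eapply Rle_trans; [|exact H16]; apply Hgen; [lra|intros; conteig|].
  intros x; rewrite Rmult_1_l; repeat apply Rabs_le_mult; try apply eigF_bound; apply eigE_bound.
- rewrite Gbar_eig; eapply Rle_trans; [|exact H16]; apply Hgen; [lra|intros; conteig|].
  intros x; rewrite Rmult_1_l; repeat apply Rabs_le_mult; try apply eigD_bound; apply eigE_bound.
Qed.

(** * Vanishing of H by orthogonality *)

(** Orthogonality to all cosines of even frequency above 2 d.  It holds for
even trigonometric polynomials with even frequencies up to 2 d, and is preserved
under the operations that build these, which makes an explicit representation by
coefficients superfluous. *)
Definition cos_orth (d : nat) (f : R -> R) : Prop :=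
  forall a, (d < a)%nat -> is_RInt (fun x => f x * cos (2 * INR a * x)) 0 (PI / 2) 0.

Lemma is_RInt_cos_even n : (0 < n)%nat ->
  is_RInt (fun x => cos (2 * INR n * x)) 0 (PI / 2) 0.
Proof.
intros Hn; assert (HN : 0 < INR n) by (apply lt_0_INR; exact Hn).
replace 0 with (sin (2 * INR n * (PI / 2)) / (2 * INR n) - sin (2 * INR n * 0) / (2 * INR n)) at 2.
- apply (is_RInt_derive (fun x => sin (2 * INR n * x) / (2 * INR n))).
  + intros x _; auto_derive; [trivial|field; lra].
  + intros x _; cont.
- replace (2 * INR n * (PI / 2)) with (INR n * PI) by field.
  rewrite sin_nat_PI, Rmult_0_r, sin_0; field; lra.
Qed.

Lemma cos_orth_ext d f g : (forall x, f x = g x) -> cos_orth d f -> cos_orth d g.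
Proof.
intros Hfg Hf a Ha; apply (is_RInt_ext (fun x => f x * cos (2 * INR a * x))).
- intros x _; rewrite Hfg; reflexivity.
- apply Hf, Ha.
Qed.

Lemma cos_orth_lin d f g u v : cos_orth d f -> cos_orth d g ->
  cos_orth d (fun x => u * f x + v * g x).
Proof.
intros Hf Hg a Ha.
replace 0 with (plus (scal u 0) (scal v 0)) at 2
  by (unfold plus, scal; simpl; unfold mult; simpl; ring).
apply (is_RInt_ext (fun x => plus (scal u (f x * cos (2 * INR a * x)))
                                  (scal v (g x * cos (2 * INR a * x))))).
- intros x _; unfold plus, scal; simpl; unfold mult; simpl; ring.
- apply (is_RInt_plus (V := R_NormedModule)); apply (is_RInt_scal (V := R_NormedModule)); auto.
Qed.

Lemma cos_orth_le d d' f : (d <= d')%nat -> cos_orth d f -> cos_orth d' f.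
Proof. intros Hd Hf a Ha; apply Hf; lia. Qed.

(** The product of cosines has the frequencies 2 (a + b) and 2 (a - b), both
above 2 d when a > d + b. *)
Lemma cos_orth_mult d b f : cos_orth d f ->
  cos_orth (d + b) (fun x => f x * cos (2 * INR b * x)).
Proof.
intros Hf a Ha.
replace 0 with (plus (scal (1 / 2) 0) (scal (1 / 2) 0)) at 2
  by (unfold plus, scal; simpl; unfold mult; simpl; ring).
apply (is_RInt_ext (fun x => plus (scal (1 / 2) (f x * cos (2 * INR (a + b) * x)))
                                  (scal (1 / 2) (f x * cos (2 * INR (a - b) * x))))).
- intros x _; rewrite plus_INR, minus_INR by lia.
  replace (2 * (INR a + INR b) * x) with (2 * INR a * x + 2 * INR b * x) by ring.
  replace (2 * (INR a - INR b) * x) with (2 * INR a * x - 2 * INR b * x) by ring.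
  rewrite cos_plus, cos_minus.
  unfold plus, scal; simpl; unfold mult; simpl; field.
- apply (is_RInt_plus (V := R_NormedModule)); apply (is_RInt_scal (V := R_NormedModule));
    apply Hf; lia.
Qed.

Lemma cos_orth_one : cos_orth 0 (fun _ => 1).
Proof.
intros a Ha; apply (is_RInt_ext (fun x => cos (2 * INR a * x))).
- intros x _; symmetry; apply Rmult_1_l.
- apply is_RInt_cos_even, Ha.
Qed.

Lemma cos_orth_cos b : cos_orth b (fun x => cos (2 * INR b * x)).
Proof.
apply (cos_orth_ext _ (fun x => 1 * cos (2 * INR b * x))); [intros; ring|].
apply (cos_orth_mult 0 b (fun _ => 1)), cos_orth_one.
Qed.

Lemma cos_orth_sinq p : cos_orth p (sinq p).
Proof.
induction p as [|p IH]; [apply cos_orth_one|].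
apply (cos_orth_ext _ (fun x => 1 * sinq p x + 2 * cos (2 * INR (S p) * x))).
- intros x; rewrite Rmult_1_l; reflexivity.
- apply cos_orth_lin; [apply (cos_orth_le p); [lia|exact IH]|apply cos_orth_cos].
Qed.

Lemma cos_orth_cos_eigE k : cos_orth (k + 2) (fun x => cos x * eigE k x).
Proof.
apply (cos_orth_ext _ (fun x =>
  1 * (omega k / 2 * sinq (S k) x + omega k / 2 * (sinq (S k) x * cos (2 * INR 1 * x)))
  + (-1) * (1 / 2 * cos (2 * INR (k + 2) * x) + 1 / 2 * cos (2 * INR (k + 1) * x)))).
- intros x; unfold eigE.
  replace (2 * INR (k + 2) * x) with (omega k * x + x)
    by (unfold omega; rewrite plus_INR; simpl; ring).
  replace (2 * INR (k + 1) * x) with (omega k * x - x)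
    by (unfold omega; rewrite plus_INR; simpl; ring).
  rewrite cos_plus, cos_minus; simpl INR; rewrite Rmult_1_r, cos_2a_cos; field.
- apply cos_orth_lin; apply cos_orth_lin.
  + apply (cos_orth_le (S k)); [lia|apply cos_orth_sinq].
  + apply (cos_orth_le (S k + 1)); [lia|apply cos_orth_mult, cos_orth_sinq].
  + apply cos_orth_cos.
  + apply (cos_orth_le (k + 1)); [lia|apply cos_orth_cos].
Qed.

Lemma cos_orth_sin_sin d f a b : cos_orth d f -> (d + b < a)%nat ->
  is_RInt (fun x => f x * (sin (2 * INR a * x) * sin (2 * INR b * x))) 0 (PI / 2) 0.
Proof.
intros Hf Hab.
replace 0 with (plus (scal (1 / 2) 0) (scal (- (1 / 2)) 0)) at 2
  by (unfold plus, scal; simpl; unfold mult; simpl; ring).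
apply (is_RInt_ext (fun x => plus (scal (1 / 2) (f x * cos (2 * INR (a - b) * x)))
                                  (scal (- (1 / 2)) (f x * cos (2 * INR (a + b) * x))))).
- intros x _; rewrite plus_INR, minus_INR by lia.
  replace (2 * (INR a + INR b) * x) with (2 * INR a * x + 2 * INR b * x) by ring.
  replace (2 * (INR a - INR b) * x) with (2 * INR a * x - 2 * INR b * x) by ring.
  rewrite cos_plus, cos_minus.
  unfold plus, scal; simpl; unfold mult; simpl; field.
- apply (is_RInt_plus (V := R_NormedModule)); apply (is_RInt_scal (V := R_NormedModule));
    apply Hf; lia.
Qed.

(** Multiplication by cos x removes the tangent and leaves the two frequencies
omega + 1 and omega - 1. *)
Lemma cos_eigF k x : cos x * eigF k x
  = (omega k - 1) / 2 * sin (2 * INR (k + 2) * x) + (omega k + 1) / 2 * sin (2 * INR (k + 1) * x).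
Proof.
unfold eigF.
replace (2 * INR (k + 2) * x) with (omega k * x + x)
  by (unfold omega; rewrite plus_INR; simpl; ring).
replace (2 * INR (k + 1) * x) with (omega k * x - x)
  by (unfold omega; rewrite plus_INR; simpl; ring).
replace (cos x * (omega k * sin (omega k * x) - sin x * cosq (S k) x))
  with (omega k * cos x * sin (omega k * x) - sin x * (cos x * cosq (S k) x)) by ring.
rewrite cosq_spec, <- omega_oddR, sin_plus, sin_minus; field.
Qed.

Lemma eigE_0_cos3 x : eigE 0 x = 8 * cos x ^ 3.
Proof.
unfold eigE, omega; simpl INR.
replace ((3 + 2 * 0) * x) with (2 * x + x) by ring.
simpl sinq; rewrite Rmult_1_r, cos_plus, sin_2a, cos_2a.
pose proof (sin2_cos2 x) as H; unfold Rsqr in H.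
replace (sin x * sin x) with (1 - cos x * cos x) by lra.
replace (2 * sin x * cos x * sin x) with (2 * cos x * (sin x * sin x)) by ring.
replace (sin x * sin x) with (1 - cos x * cos x) by lra. ring.
Qed.

(** The integrand is 8 (cos F_i) (cos F_j) (cos E_k).  The first factor has
frequencies at least 2 (i + 1), the second at most 2 (j + 2) and the third at
most 2 (k + 2). *)
Lemma H0_zero i j k : (j + k + 4 <= i)%nat -> H0 j k i = 0.
Proof.
intros Hi; rewrite H0_eig.
enough (HI : is_RInt (fun x => eigE 0 x * (eigF i x * (eigF j x * eigE k x))) 0 (PI / 2) 0).
{ rewrite (is_RInt_unique _ _ _ _ HI); ring. }
set (T := fun a b x => (cos x * eigE k x) * (sin (2 * INR a * x) * sin (2 * INR b * x))).
assert (HT : forall a b, (k + 2 + b < a)%nat -> is_RInt (T a b) 0 (PI / 2) 0).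
{ intros; apply (cos_orth_sin_sin (k + 2) (fun x => cos x * eigE k x)); [apply cos_orth_cos_eigE|assumption]. }
set (c1 := 2 * (omega i - 1)); set (c2 := 2 * (omega i + 1)).
set (d1 := omega j - 1); set (d2 := omega j + 1).
assert (HS : is_RInt (fun x =>
   plus (plus (scal (c1 * d1) (T (i + 2)%nat (j + 2)%nat x)) (scal (c1 * d2) (T (i + 2)%nat (j + 1)%nat x)))
        (plus (scal (c2 * d1) (T (i + 1)%nat (j + 2)%nat x)) (scal (c2 * d2) (T (i + 1)%nat (j + 1)%nat x))))
   0 (PI / 2) (plus (plus (scal (c1 * d1) 0) (scal (c1 * d2) 0))
                    (plus (scal (c2 * d1) 0) (scal (c2 * d2) 0)))).
{ apply (is_RInt_plus (V := R_NormedModule)); apply (is_RInt_plus (V := R_NormedModule));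
  apply (is_RInt_scal (V := R_NormedModule)); apply HT; lia. }
replace (plus (plus (scal (c1 * d1) 0) (scal (c1 * d2) 0))
              (plus (scal (c2 * d1) 0) (scal (c2 * d2) 0))) with 0 in HS
  by (unfold plus, scal; simpl; unfold mult; simpl; ring).
refine (is_RInt_ext _ _ _ _ _ _ HS).
intros x _; rewrite eigE_0_cos3.
replace (8 * cos x ^ 3 * (eigF i x * (eigF j x * eigE k x)))
  with (8 * (cos x * eigF i x) * (cos x * eigF j x) * (cos x * eigE k x)) by ring.
rewrite !cos_eigF; unfold T, c1, c2, d1, d2, plus, scal; simpl; unfold mult; simpl; field.
Qed.

(** * The integral of sin(n x) cot x *)

(** The integral of sin((2p+1)x) cot x. *)
Definition cot_int (p : nat) : R := RInt (fun x => cos x * sinq p x) 0 (PI / 2).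

Lemma is_RInt_cot_int p : is_RInt (fun x => cos x * sinq p x) 0 (PI / 2) (cot_int p).
Proof. apply (RInt_correct (V := R_CompleteNormedModule)), ex_RInt_cont; intros; cont. Qed.

(** sin((n+2)x) cot x - sin(n x) cot x = cos(n x) + cos((n+2)x). *)
Lemma cot_int_S p : cot_int (S p) = cot_int p + (-1) ^ p * (/ oddR p - / oddR (S p)).
Proof.
pose proof (oddR_ge1 p); pose proof (oddR_ge1 (S p)).
apply is_RInt_unique.
set (P := fun x => sin (oddR p * x) / oddR p + sin (oddR (S p) * x) / oddR (S p)).
assert (HP : is_RInt (fun x => cos (oddR p * x) + cos (oddR (S p) * x)) 0 (PI / 2)
              (P (PI / 2) - P 0)).
{ apply (is_RInt_derive P).
  - intros x _; unfold P; auto_derive; [trivial|field; lra].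
  - intros x _; cont. }
replace (P (PI / 2) - P 0) with ((-1) ^ p * (/ oddR p - / oddR (S p))) in HP.
2:{ unfold P; rewrite !sin_odd_PI2, !Rmult_0_r, sin_0; simpl; field; lra. }
apply (is_RInt_ext (fun x => plus (cos x * sinq p x) (cos (oddR p * x) + cos (oddR (S p) * x)))).
- intros x _; simpl sinq.
  replace (oddR p * x) with (2 * INR (S p) * x - x) by (unfold oddR; rewrite S_INR; ring).
  replace (oddR (S p) * x) with (2 * INR (S p) * x + x) by (unfold oddR; ring).
  change (match p with 0%nat => 1 | S _ => INR p + 1 end) with (INR (S p)).
  rewrite cos_plus, cos_minus; unfold plus; simpl; ring.
- apply (is_RInt_plus (V := R_NormedModule)); [apply is_RInt_cot_int|exact HP].
Qed.

(** The increments of [cot_int] alternate in sign and have size 2/(n(n+2)), close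
to 1/n^2 + 1/(n+2)^2; the correction cancels them up to 4/(n^2 (n+2)^2). *)
Definition cot_int_corr (p : nat) : R := cot_int p + (-1) ^ p / oddR p ^ 2.

(** The right-hand side is a telescoping majorant of 4/(n^2 (n+2)^2). *)
Lemma cot_int_corr_step p : Rabs (cot_int_corr (S p) - cot_int_corr p) <= / oddR p ^ 3 - / oddR (S p) ^ 3.
Proof.
unfold cot_int_corr; rewrite cot_int_S, oddR_S; pose proof (oddR_ge1 p) as Hn; set (n := oddR p) in *.
replace (cot_int p + (-1) ^ p * (/ n - / (n + 2)) + (-1) ^ S p / (n + 2) ^ 2 - (cot_int p + (-1) ^ p / n ^ 2))
  with ((-1) ^ p * - (4 / (n ^ 2 * (n + 2) ^ 2))) by (simpl; field; lra).
assert (H4 : 0 < n ^ 3 * (n + 2) ^ 3) by (apply Rmult_lt_0_compat; apply pow_lt; lra).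
rewrite Rabs_mult, pow_1_abs, Rmult_1_l, Rabs_Ropp, Rabs_pos_eq.
- apply Rminus_le.
  replace (4 / (n ^ 2 * (n + 2) ^ 2) - (/ n ^ 3 - / (n + 2) ^ 3))
    with (- ((2 * n ^ 2 + 4 * n + 8) / (n ^ 3 * (n + 2) ^ 3))) by (field; lra).
  apply Rge_le, Ropp_0_le_ge_contravar, Rlt_le, Rdiv_lt_0_compat; [nra|exact H4].
- apply Rlt_le, Rdiv_lt_0_compat; [lra|].
  apply Rmult_lt_0_compat; apply pow_lt; lra.
Qed.

Lemma cot_int_corr_close p r : Rabs (cot_int_corr (p + r) - cot_int_corr p) <= / oddR p ^ 3.
Proof.
enough (H : Rabs (cot_int_corr (p + r) - cot_int_corr p) <= / oddR p ^ 3 - / oddR (p + r) ^ 3).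
{ assert (0 < / oddR (p + r) ^ 3)
    by (apply Rinv_0_lt_compat, pow_lt; pose proof (oddR_ge1 (p + r)); lra). lra. }
induction r as [|r IH].
- rewrite Nat.add_0_r, !Rminus_diag, Rabs_R0; lra.
- rewrite Nat.add_succ_r; pose proof (cot_int_corr_step (p + r)) as H.
  replace (cot_int_corr (S (p + r)) - cot_int_corr p)
    with ((cot_int_corr (S (p + r)) - cot_int_corr (p + r)) + (cot_int_corr (p + r) - cot_int_corr p)) by ring.
  eapply Rle_trans; [apply Rabs_triang|lra].
Qed.

(** * Exact formula and decay estimate for G *)

(** The primitive of -A cos(n x) - Q (sin(n x) tan x - cos(n x) tan^2 x / n) for
n = 2p+1; the combination multiplied by Q is regular at pi/2, unlike its two
terms. *)
Definition antider (p : nat) (A Q x : R) : R :=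
  Q / oddR p * (cosq p x * sin x) - (A / oddR p + Q / oddR p ^ 2) * sin (oddR p * x).

Lemma continuous_antider p A Q x : continuous (antider p A Q) x.
Proof. unfold antider; cont. Qed.

Lemma is_derive_antider p A Q x : 0 < x < PI / 2 ->
  is_derive (antider p A Q) x
    (- A * cos (oddR p * x)
     - Q * (sin (oddR p * x) * tan x - cos (oddR p * x) * tan x ^ 2 / oddR p)).
Proof.
intros Hx; destruct (sin_cos_pos x Hx) as [Hs Hc]; pose proof (oddR_ge1 p).
apply (is_derive_ext_loc (fun x =>
  Q / oddR p * (cos (oddR p * x) * tan x) - (A / oddR p + Q / oddR p ^ 2) * sin (oddR p * x))).
- apply (locally_Ioo 0 (PI / 2)); [exact Hx|]; intros y Hy; unfold antider.
  apply sin_cos_pos in Hy; rewrite <- cosq_spec; unfold tan.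
  match goal with |- @eq _ ?a ?b => change (@eq R a b) end; field; lra.
- assert (Ht : is_derive tan x (tan x ^ 2 + 1)) by (apply is_derive_tan; lra).
  auto_derive; [eexists; exact Ht|].
  assert (HD : Derive (fun y : R => tan y) x = tan x ^ 2 + 1) by apply is_derive_unique, Ht.
  rewrite HD; field; lra.
Qed.

Lemma antider_0 p A Q : antider p A Q 0 = 0.
Proof. unfold antider; rewrite Rmult_0_r, sin_0; ring. Qed.

Lemma cosq_PI2 p : cosq p (PI / 2) = oddR p * (-1) ^ p.
Proof.
induction p as [|p IH]; [unfold oddR; simpl; ring|].
simpl cosq; rewrite IH.
change (match p with 0%nat => 1 | S _ => INR p + 1 end) with (INR (S p)).
replace (2 * INR (S p) * (PI / 2)) with (INR (S p) * PI) by field.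
rewrite cos_nat_PI, oddR_S; simpl; ring.
Qed.

Lemma antider_PI2 p A Q :
  antider p A Q (PI / 2) = (-1) ^ p * (Q - A / oddR p - Q / oddR p ^ 2).
Proof.
pose proof (oddR_ge1 p).
unfold antider; rewrite cosq_PI2, sin_odd_PI2, sin_PI2; field; lra.
Qed.

(** The first and second elementary symmetric functions of 1/X, s/Y, t/Z, the
reciprocals of the terms of X + s Y + t Z when s and t are signs. *)
Definition recip_sum (X Y Z s t : R) : R := / X + s / Y + t / Z.
Definition recip_prod (X Y Z s t : R) : R := s / (X * Y) + s * t / (Y * Z) + t / (X * Z).

(** Product-to-sum formulas for the three factors
X sin(X x) - cos(X x) tan x, Y sin(Y x) - cos(Y x) tan x and
Z sin(Z x) cot x - cos(Z x).  After division by X Y Z, the coefficients in the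
summand of n = X + s Y + t Z are the elementary symmetric functions of
1/X, s/Y, t/Z, and the third one is the second one divided by n. *)
Lemma FFE_pointwise i j k p p2 p3 p4 X Y Z
  (HXi : X = omega i) (HYj : Y = omega j) (HZk : Z = omega k)
  (odd_p1 : oddR p = X - Y - Z) (odd_p2 : oddR p2 = X + Y - Z)
  (odd_p3 : oddR p3 = X - Y + Z) (odd_p4 : oddR p4 = X + Y + Z) x : 0 < x < PI / 2 ->
  4 / (X * Y * Z) * (eigF i x * (eigF j x * eigE k x))
  = - (cos x * sinq p x) + cos x * sinq p2 x + cos x * sinq p3 x - cos x * sinq p4 x
  + (- (- recip_sum X Y Z (-1) (-1) * cos (oddR p * x) - recip_prod X Y Z (-1) (-1) * (sin (oddR p * x) * tan x - cos (oddR p * x) * tan x ^ 2 / oddR p))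
     + (- recip_sum X Y Z 1 (-1) * cos (oddR p2 * x) - recip_prod X Y Z 1 (-1) * (sin (oddR p2 * x) * tan x - cos (oddR p2 * x) * tan x ^ 2 / oddR p2))
     + (- recip_sum X Y Z (-1) 1 * cos (oddR p3 * x) - recip_prod X Y Z (-1) 1 * (sin (oddR p3 * x) * tan x - cos (oddR p3 * x) * tan x ^ 2 / oddR p3))
     - (- recip_sum X Y Z 1 1 * cos (oddR p4 * x) - recip_prod X Y Z 1 1 * (sin (oddR p4 * x) * tan x - cos (oddR p4 * x) * tan x ^ 2 / oddR p4))).
Proof.
intros Hx; destruct (sin_cos_pos x Hx) as [Hs Hc].
pose proof (oddR_ge1 p) as O1; pose proof (oddR_ge1 p2) as O2;
pose proof (oddR_ge1 p3) as O3; pose proof (oddR_ge1 p4) as O4.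
pose proof (omega_ge3 i) as HX; pose proof (omega_ge3 j) as HY; pose proof (omega_ge3 k) as HZ.
rewrite <- HXi in HX; rewrite <- HYj in HY; rewrite <- HZk in HZ.
assert (Hq : forall q, cos x * sinq q x = cos x * sin (oddR q * x) / sin x).
{ intros q; rewrite <- sinq_spec; field; lra. }
rewrite !Hq.
(* The second symmetric function is n times the third, which removes the
   division by n and leaves a polynomial identity in the sines and cosines. *)
assert (Hred : forall s t n u v, n = X + s * Y + t * Z -> 1 <= n -> s * s = 1 -> t * t = 1 ->
  recip_prod X Y Z s t * (u * tan x - v * tan x ^ 2 / n)
  = recip_prod X Y Z s t * (u * tan x) - s * t / (X * Y * Z) * (v * tan x ^ 2)).
{ intros s t n u v Hn Hn1 Hss Htt.
  assert (Hqn : recip_prod X Y Z s t = n * (s * t / (X * Y * Z))).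
  { unfold recip_prod; rewrite Hn; field_simplify_eq; [|lra].
    replace (s ^ 2) with 1 by lra. replace (t ^ 2) with 1 by lra. ring. }
  rewrite Rmult_minus_distr_l; f_equal; rewrite Hqn; field; lra. }
rewrite (Hred (-1) (-1) (oddR p)) by (try exact O1; try ring; rewrite odd_p1; ring).
rewrite (Hred 1 (-1) (oddR p2)) by (try exact O2; try ring; rewrite odd_p2; ring).
rewrite (Hred (-1) 1 (oddR p3)) by (try exact O3; try ring; rewrite odd_p3; ring).
rewrite (Hred 1 1 (oddR p4)) by (try exact O4; try ring; rewrite odd_p4; ring).
rewrite odd_p1, odd_p2, odd_p3, odd_p4.
rewrite !eigF_quot, eigE_quot by lra.
rewrite <- HXi, <- HYj, <- HZk.
replace ((X - Y - Z) * x) with (X * x - Y * x - Z * x) by ring.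
replace ((X + Y - Z) * x) with (X * x + Y * x - Z * x) by ring.
replace ((X - Y + Z) * x) with (X * x - Y * x + Z * x) by ring.
replace ((X + Y + Z) * x) with (X * x + Y * x + Z * x) by ring.
repeat (rewrite ?sin_plus, ?cos_plus, ?sin_minus, ?cos_minus).
unfold recip_sum, recip_prod, tan.
generalize (sin (X * x)), (sin (Y * x)), (sin (Z * x)), (cos (X * x)), (cos (Y * x)), (cos (Z * x)).
intros a b c a' b' c'.
set (s := sin x) in *. set (co := cos x) in *. clearbody s co.
field. lra.
Qed.

Lemma RInt_FFE i j k p p2 p3 p4 X Y Z
  (HXi : X = omega i) (HYj : Y = omega j) (HZk : Z = omega k)
  (odd_p1 : oddR p = X - Y - Z) (odd_p2 : oddR p2 = X + Y - Z)
  (odd_p3 : oddR p3 = X - Y + Z) (odd_p4 : oddR p4 = X + Y + Z) :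
  4 / (X * Y * Z) * RInt (fun x => eigF i x * (eigF j x * eigE k x)) 0 (PI / 2)
  = - cot_int p + cot_int p2 + cot_int p3 - cot_int p4
    + (- antider p (recip_sum X Y Z (-1) (-1)) (recip_prod X Y Z (-1) (-1)) (PI / 2) + antider p2 (recip_sum X Y Z 1 (-1)) (recip_prod X Y Z 1 (-1)) (PI / 2)
       + antider p3 (recip_sum X Y Z (-1) 1) (recip_prod X Y Z (-1) 1) (PI / 2) - antider p4 (recip_sum X Y Z 1 1) (recip_prod X Y Z 1 1) (PI / 2)).
Proof.
set (Phi := fun x =>
   - antider p (recip_sum X Y Z (-1) (-1)) (recip_prod X Y Z (-1) (-1)) x + antider p2 (recip_sum X Y Z 1 (-1)) (recip_prod X Y Z 1 (-1)) x
       + antider p3 (recip_sum X Y Z (-1) 1) (recip_prod X Y Z (-1) 1) x - antider p4 (recip_sum X Y Z 1 1) (recip_prod X Y Z 1 1) x).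
(* M collects the terms sin(n x) cot x, and Phi is a primitive of the rest. *)
set (M := fun x => - (cos x * sinq p x) + cos x * sinq p2 x + cos x * sinq p3 x - cos x * sinq p4 x).
set (T := fun x => 4 / (X * Y * Z) * (eigF i x * (eigF j x * eigE k x)) - M x).
assert (HM : is_RInt M 0 (PI / 2) (- cot_int p + cot_int p2 + cot_int p3 - cot_int p4)).
{ apply (is_RInt_minus (V := R_NormedModule)); [|apply is_RInt_cot_int].
  apply (is_RInt_plus (V := R_NormedModule)); [|apply is_RInt_cot_int].
  apply (is_RInt_plus (V := R_NormedModule)); [|apply is_RInt_cot_int].
  apply (is_RInt_opp (V := R_NormedModule)), is_RInt_cot_int. }
assert (HT : is_RInt T 0 (PI / 2) (Phi (PI / 2) - Phi 0)).
{ apply is_RInt_derive_open.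
  - pose proof PI_RGT_0; lra.
  - intros x; unfold Phi.
    apply (continuous_Rminus (fun x => _ + _)); [|apply continuous_antider].
    apply (continuous_Rplus (fun x => _ + _)); [|apply continuous_antider].
    apply (continuous_Rplus (fun x => - _)); [|apply continuous_antider].
    apply (continuous_opp (antider p _ _)), continuous_antider.
  - intros x; unfold T, M.
    apply continuous_Rminus; [conteig|].
    apply (continuous_Rminus (fun x => _ + _)); [|cont].
    apply (continuous_Rplus (fun x => _ + _)); [|cont].
    apply (continuous_Rplus (fun x => - _)); [|cont].
    apply (continuous_opp (fun x => cos x * sinq p x)); cont.
  - intros x Hx.
    evar (d : R); replace (T x) with d.
    + apply (is_derive_minus (fun x => _ + _)); [|apply is_derive_antider, Hx].
      apply (is_derive_plus (fun x => _ + _)); [|apply is_derive_antider, Hx].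
      apply (is_derive_plus (fun x => - _)); [|apply is_derive_antider, Hx].
      apply (is_derive_opp (antider p _ _)), is_derive_antider, Hx.
    + unfold T, M; rewrite (FFE_pointwise i j k p p2 p3 p4 X Y Z) by assumption.
      unfold d, minus, plus, opp; simpl; ring. }
assert (HS := is_RInt_plus (V := R_NormedModule) _ _ _ _ _ _ HM HT).
rewrite <- (RInt_scal (V := R_CompleteNormedModule)) by (apply ex_RInt_cont; intros; conteig).
apply is_RInt_unique.
unfold Phi in HS at 2; rewrite !antider_0 in HS.
match goal with |- is_RInt _ _ _ ?v => match type of HS with is_RInt _ _ _ ?w =>
  replace v with w by (unfold plus; simpl; unfold Phi; ring) end end.
refine (is_RInt_ext _ _ _ _ _ _ HS).
intros x _; unfold T, plus, scal; simpl; unfold mult; simpl; ring.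
Qed.

(** The rational part of the exact formula for G, in a form that displays its
size: with 4 Y^2 outside, the main term is the square of a difference, and the
other term has all four frequencies in the denominator. *)
Definition rat_part (m Y Z : R) : R :=
  4 * Y ^ 2 * (/ (m * (m + 2 * Y)) - / ((m + 2 * Z) * (m + 2 * Y + 2 * Z))) ^ 2
   + 8 / (m * (m + 2 * Y) * ((m + 2 * Z) * (m + 2 * Y + 2 * Z))).

(** The 1/n^2 comes from the correction in [cot_int_corr], the other terms from
the values of [antider] at pi/2. *)
Lemma sign_sum_rat_part m Y Z : 0 < m -> 0 < Y -> 0 < Z ->
  let X := m + Y + Z in
  let V n s t := / n ^ 2 - recip_prod X Y Z s t + recip_sum X Y Z s t / n
                 + recip_prod X Y Z s t / n ^ 2 in
  V m (-1) (-1) + V (m + 2 * Y) 1 (-1) + V (m + 2 * Z) (-1) 1 + V (m + 2 * Y + 2 * Z) 1 1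
  = rat_part m Y Z.
Proof.
intros Hm HY HZ X V; unfold V, X, rat_part, recip_sum, recip_prod; field; lra.
Qed.

(** The factor (Y + m) / Y is absorbed because Y + m is smaller than the
frequency v = m + 2 Y, which occurs in every denominator, and because 1/m^3 has
one power of 1/m to spare. *)
Lemma rat_part_bound m Y Z : 1 <= m -> 1 <= Y -> 1 <= Z ->
  0 <= rat_part m Y Z /\ (2 / m ^ 3 + rat_part m Y Z) * ((Y + m) / Y) <= 16 / m ^ 2.
Proof.
intros Hm HY HZ; unfold rat_part.
set (v := m + 2 * Y); set (w := m + 2 * Z); set (z := v + 2 * Z).
assert (Hv : 1 <= v) by (unfold v; lra). assert (Hw : m <= w) by (unfold w; lra).
assert (Hz : v <= z) by (unfold z; lra). assert (HYv : Y + m <= v) by (unfold v; lra).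
assert (HYv' : Y <= v) by (unfold v; lra).
assert (Hmv : 0 < m * v) by nra. assert (Hwz : m * v <= w * z) by nra.
assert (Hm2 : 0 < m ^ 2) by nra. 
assert (P8 : 0 < 8 / (m * v * (w * z))) by (apply Rdiv_lt_0_compat; nra).
split.
{ apply Rplus_le_le_0_compat; [|lra]. apply Rmult_le_pos; [nra|apply pow2_ge_0]. }
set (u := (Y + m) / Y).
assert (Hu : 0 < u) by (apply Rdiv_lt_0_compat; lra).
assert (T1 : 2 / m ^ 3 * u <= 4 / m ^ 2).
{ unfold u; replace (2 / m ^ 3 * ((Y + m) / Y)) with (2 / m ^ 2 * (/ m + / Y)) by (field; lra).
  replace (4 / m ^ 2) with (2 / m ^ 2 * 2) by (field; lra).
  apply Rmult_le_compat_l; [apply Rlt_le, Rdiv_lt_0_compat; lra|].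
  assert (/ m <= 1) by (rewrite <- Rinv_1; apply Rinv_le_contravar; lra).
  assert (/ Y <= 1) by (rewrite <- Rinv_1; apply Rinv_le_contravar; lra). lra. }
assert (T2 : 4 * Y ^ 2 * (/ (m * v) - / (w * z)) ^ 2 * u <= 4 / m ^ 2).
{ apply Rle_trans with (4 * Y ^ 2 * (/ (m * v)) ^ 2 * u).
  - apply Rmult_le_compat_r; [lra|]. apply Rmult_le_compat_l; [nra|].
    assert (0 < / (w * z)) by (apply Rinv_0_lt_compat; lra).
    assert (/ (w * z) <= / (m * v)) by (apply Rinv_le_contravar; lra).
    apply pow_incr; lra.
  - unfold u; replace (4 * Y ^ 2 * (/ (m * v)) ^ 2 * ((Y + m) / Y))
      with (4 / m ^ 2 * ((Y * (Y + m)) / v ^ 2)) by (field; lra).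
    rewrite <- (Rmult_1_r (4 / m ^ 2)) at 2.
    apply Rmult_le_compat_l; [apply Rlt_le, Rdiv_lt_0_compat; lra|].
    apply (Rmult_le_reg_r (v ^ 2)); [nra|].
    replace (Y * (Y + m) / v ^ 2 * v ^ 2) with (Y * (Y + m)) by (field; lra). nra. }
assert (T3 : 8 / (m * v * (w * z)) * u <= 8 / m ^ 2).
{ unfold u; replace (8 / (m * v * (w * z)) * ((Y + m) / Y))
    with (8 / m ^ 2 * ((m / w) * ((Y + m) / v) * / (Y * z))) by (field; lra).
  rewrite <- (Rmult_1_r (8 / m ^ 2)) at 2.
  apply Rmult_le_compat_l; [apply Rlt_le, Rdiv_lt_0_compat; lra|].
  assert (0 < m / w <= 1).
  { split; [apply Rdiv_lt_0_compat; lra|]. apply (Rmult_le_reg_r w); [lra|].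
    replace (m / w * w) with m by (field; lra); lra. }
  assert (0 < (Y + m) / v <= 1).
  { split; [apply Rdiv_lt_0_compat; lra|]. apply (Rmult_le_reg_r v); [lra|].
    replace ((Y + m) / v * v) with (Y + m) by (field; lra); lra. }
  assert (0 < / (Y * z) <= 1).
  { split; [apply Rinv_0_lt_compat; nra|]. rewrite <- Rinv_1; apply Rinv_le_contravar; nra. }
  assert (0 < (m / w) * ((Y + m) / v) <= 1) by nra. nra. }
replace (16 / m ^ 2) with (4 / m ^ 2 + 4 / m ^ 2 + 8 / m ^ 2) by (field; lra).
rewrite !Rmult_plus_distr_r; lra.
Qed.

(** The four frequencies are grouped into the pairs (X - Y - Z, X + Y - Z) and
(X - Y + Z, X + Y + Z).  Within a pair the corrected integrals of sin(n x) cot x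
enter with opposite signs, so only their O(1/m^3) variation counts. *)
Lemma RInt_FFE_bound p j k (i := (p + j + k + 2)%nat) (X := omega i) (Y := omega j) (Z := omega k) :
  Rabs (RInt (fun x => eigF i x * (eigF j x * eigE k x)) 0 (PI / 2))
    * ((Y + oddR p) / Y) <= 4 / oddR p ^ 2 * (X * Y * Z).
Proof.
pose proof (oddR_ge1 p) as Hm.
pose proof (omega_ge3 i) as HX; pose proof (omega_ge3 j) as HY; pose proof (omega_ge3 k) as HZ.
fold X in HX; fold Y in HY; fold Z in HZ.
set (p2 := (p + (2 * j + 3))%nat).
set (p3 := (p + (2 * k + 3))%nat).
set (p4 := (p3 + (2 * j + 3))%nat).
assert (odd_p1 : oddR p = X - Y - Z)
  by (unfold X, Y, Z, i, omega, oddR; rewrite !plus_INR; simpl; ring).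
assert (odd_p2 : oddR p2 = X + Y - Z)
  by (unfold p2, X, Y, Z, i, omega, oddR; rewrite !plus_INR, !mult_INR; simpl; ring).
assert (odd_p3 : oddR p3 = X - Y + Z)
  by (unfold p3, X, Y, Z, i, omega, oddR; rewrite !plus_INR, !mult_INR; simpl; ring).
assert (odd_p4 : oddR p4 = X + Y + Z)
  by (unfold p4, p3, X, Y, Z, i, omega, oddR; rewrite !plus_INR, !mult_INR; simpl; ring).
assert (HF := RInt_FFE i j k p p2 p3 p4 X Y Z eq_refl eq_refl eq_refl odd_p1 odd_p2 odd_p3 odd_p4).
rewrite !antider_PI2 in HF.
set (I := RInt _ _ _) in *.
assert (E2 : (-1) ^ p2 = - (-1) ^ p).
{ unfold p2; rewrite pow_add; replace (2 * j + 3)%nat with (S (2 * (j + 1))) by lia.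
  rewrite pow_1_odd; ring. }
assert (E3 : (-1) ^ p3 = - (-1) ^ p).
{ unfold p3; rewrite pow_add; replace (2 * k + 3)%nat with (S (2 * (k + 1))) by lia.
  rewrite pow_1_odd; ring. }
assert (E4 : (-1) ^ p4 = (-1) ^ p).
{ unfold p4; rewrite pow_add, E3; replace (2 * j + 3)%nat with (S (2 * (j + 1))) by lia.
  rewrite pow_1_odd; ring. }
set (m := oddR p) in *.
assert (B1 : Rabs (cot_int_corr p2 - cot_int_corr p) <= / m ^ 3) by apply cot_int_corr_close.
assert (O3 : oddR p3 = m + 2 * Z) by (rewrite odd_p3; lra).
assert (O2 : oddR p2 = m + 2 * Y) by (rewrite odd_p2; lra).
assert (O4 : oddR p4 = m + 2 * Y + 2 * Z) by (rewrite odd_p4; lra).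
assert (OX : X = m + Y + Z) by (lra).
assert (B2 : Rabs (cot_int_corr p4 - cot_int_corr p3) <= / m ^ 3).
{ eapply Rle_trans; [apply cot_int_corr_close|]. rewrite O3.
  apply Rinv_le_contravar; [apply pow_lt; lra|apply pow_incr; lra]. }
unfold cot_int_corr in B1, B2; rewrite E2 in B1; rewrite E3, E4 in B2.
rewrite E2, E3, E4 in HF; rewrite O2, O3, O4 in *.
assert (HR := sign_sum_rat_part m Y Z ltac:(lra) ltac:(lra) ltac:(lra)).
destruct (rat_part_bound m Y Z ltac:(lra) ltac:(lra) ltac:(lra)) as [HR0 HR1].
cbv zeta in HR; rewrite <- OX in HR.
set (R0 := rat_part m Y Z) in *.
set (eps := (-1) ^ p) in *.
assert (HI : 4 / (X * Y * Z) * I =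
   (cot_int p2 + - eps / (m + 2 * Y) ^ 2 - (cot_int p + eps / m ^ 2))
   - (cot_int p4 + eps / (m + 2 * Y + 2 * Z) ^ 2 - (cot_int p3 + - eps / (m + 2 * Z) ^ 2))
   + eps * R0).
{ rewrite HF, <- HR; unfold Rdiv; ring. }
clear HF HR.
assert (Heps : Rabs (eps * R0) = R0)
  by (rewrite Rabs_mult; unfold eps; rewrite pow_1_abs, Rabs_pos_eq by exact HR0; ring).
assert (HXYZ : 0 < X * Y * Z) by (repeat apply Rmult_lt_0_compat; lra).
assert (HA : Rabs (4 / (X * Y * Z) * I) <= 2 / m ^ 3 + R0).
{ rewrite HI.
  eapply Rle_trans; [apply Rabs_triang|]; rewrite Heps.
  apply Rplus_le_compat_r.
  replace (2 / m ^ 3) with (/ m ^ 3 + / m ^ 3) by (field; lra).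
  apply Rabs_le_minus; assumption. }
replace (Rabs I) with (Rabs (4 / (X * Y * Z) * I) * (X * Y * Z / 4)).
2:{ rewrite Rabs_mult, (Rabs_pos_eq (4 / _)) by (apply Rlt_le, Rdiv_lt_0_compat; lra).
  field; lra. }
apply Rle_trans with ((2 / m ^ 3 + R0) * ((Y + m) / Y) * (X * Y * Z / 4)).
- rewrite !Rmult_assoc; rewrite (Rmult_comm (X * (Y * Z) / 4)), <- !Rmult_assoc.
  apply Rmult_le_compat_r; [lra|]. apply Rmult_le_compat_r; [|exact HA].
  apply Rlt_le, Rdiv_lt_0_compat; lra.
- replace (4 / m ^ 2 * (X * Y * Z)) with (16 / m ^ 2 * (X * Y * Z / 4)) by (field; lra).
  apply Rmult_le_compat_r; [lra|exact HR1].
Qed.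

(** * Gbar as a multiple of G *)

Lemma eigE_PI2 k : eigE k (PI / 2) = 0.
Proof. unfold eigE; rewrite omega_oddR, cos_odd_PI2, cos_PI2; ring. Qed.

Lemma eigF_0 k : eigF k 0 = 0.
Proof. unfold eigF; rewrite Rmult_0_r, sin_0; ring. Qed.

(** With f = e_i, g = e_j, h = e_k and weight tan^2 x, the function to integrate
is the derivative of tan^2 x (h f' g + h g' f - f g h'): each eigenvalue equation
contributes a square of a frequency times tan^2 x f g h, and of the products of
two derivatives only 2 h f' g' survives.  The boundary terms vanish since F is
zero at 0 and E at pi/2. *)
Lemma RInt_DDE_FFE i j k :
  2 * omega i * omega j * RInt (fun x => eigD i x * (eigD j x * eigE k x)) 0 (PI / 2)
  = (omega i ^ 2 + omega j ^ 2 - omega k ^ 2)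
    * RInt (fun x => eigF i x * (eigF j x * eigE k x)) 0 (PI / 2).
Proof.
set (X := omega i); set (Y := omega j); set (Z := omega k).
set (W := fun x => X * (eigE k x * (eigD i x * eigF j x)) + Y * (eigE k x * (eigD j x * eigF i x))
                   - Z * (eigF i x * (eigE j x * eigD k x))).
set (w := fun x => 2 * X * Y * (eigD i x * (eigD j x * eigE k x))
                   - (X ^ 2 + Y ^ 2 - Z ^ 2) * (eigF i x * (eigF j x * eigE k x))).
assert (HW : is_RInt w 0 (PI / 2) (W (PI / 2) - W 0)).
{ apply is_RInt_derive_open.
  - pose proof PI_RGT_0; lra.
  - intros x; unfold W; conteig.
  - intros x; unfold w; conteig.
  - intros x Hx; destruct (sin_cos_pos x Hx) as [Hs Hc].
    assert (Ht : tan x <> 0)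
      by (unfold tan; apply Rgt_not_eq, Rdiv_lt_0_compat; lra).
    pose proof (is_derive_eigE i x Hx) as Ei; pose proof (is_derive_eigE j x Hx) as Ej;
    pose proof (is_derive_eigE k x Hx) as Ek; pose proof (is_derive_eigF i x Hx) as Fi;
    pose proof (is_derive_eigF j x Hx) as Fj; pose proof (is_derive_eigD i x Hx) as Di;
    pose proof (is_derive_eigD j x Hx) as Dj; pose proof (is_derive_eigD k x Hx) as Dk.
    unfold W; auto_derive.
    + repeat split; eexists; eassumption.
    + replace (Derive (fun x => eigE k x) x) with (omega k * eigD k x / tan x) by (symmetry; apply is_derive_unique, Ek).
      replace (Derive (fun x => eigE j x) x) with (omega j * eigD j x / tan x) by (symmetry; apply is_derive_unique, Ej).
      replace (Derive (fun x => eigF i x) x) with ((1 + tan x ^ 2) * eigE i x + omega i * eigD i x) by (symmetry; apply is_derive_unique, Fi).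
      replace (Derive (fun x => eigF j x) x) with ((1 + tan x ^ 2) * eigE j x + omega j * eigD j x) by (symmetry; apply is_derive_unique, Fj).
      replace (Derive (fun x => eigD i x) x) with (- omega i * eigF i x - (1 + tan x ^ 2) * eigD i x / tan x) by (symmetry; apply is_derive_unique, Di).
      replace (Derive (fun x => eigD j x) x) with (- omega j * eigF j x - (1 + tan x ^ 2) * eigD j x / tan x) by (symmetry; apply is_derive_unique, Dj).
      replace (Derive (fun x => eigD k x) x) with (- omega k * eigF k x - (1 + tan x ^ 2) * eigD k x / tan x) by (symmetry; apply is_derive_unique, Dk).
      unfold w; rewrite !eigF_tan by exact Hx; fold X Y Z; field; exact Ht. }
replace (W (PI / 2) - W 0) with 0 in HW
  by (unfold W; rewrite !eigE_PI2, !eigF_0; ring).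
assert (HV := is_RInt_minus (V := R_NormedModule) _ _ 0 (PI / 2) _ _
  (is_RInt_scal (V := R_NormedModule) _ _ _ (2 * X * Y) _
    (RInt_correct (V := R_CompleteNormedModule) (fun x => eigD i x * (eigD j x * eigE k x)) 0 (PI / 2)
       ltac:(apply ex_RInt_cont; intros; conteig)))
  (is_RInt_scal (V := R_NormedModule) _ _ _ (X ^ 2 + Y ^ 2 - Z ^ 2) _
    (RInt_correct (V := R_CompleteNormedModule) (fun x => eigF i x * (eigF j x * eigE k x)) 0 (PI / 2)
       ltac:(apply ex_RInt_cont; intros; conteig)))).
apply Rminus_diag_uniq.
apply (is_RInt_unique (V := R_CompleteNormedModule)) in HV, HW.
etransitivity; [symmetry; exact HV|exact HW].
Qed.

(** From X = m + Y + Z one gets X^2 - Z^2 = (m + Y) (X + Z) <= 2 X (m + Y) and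
Y^2 <= X Y, hence (X^2 + Y^2 - Z^2) / (2 X Y) <= 2 (Y + m) / Y. *)
Lemma decay_bounds : exists K, 0 <= K /\ forall p j k, let i := (p + j + k + 2)%nat in
  Rabs (G j k i) <= K / oddR p ^ 2 /\ Rabs (Gbar j k i) <= K / oddR p ^ 2.
Proof.
destruct normc_product_bound as [K [HK HB]].
exists (8 * K); split; [lra|]; intros p j k i.
pose proof (RInt_FFE_bound p j k) as HI; cbv zeta in HI; fold i in HI.
pose proof (RInt_DDE_FFE i j k) as HD.
pose proof (oddR_ge1 p) as Hm.
pose proof (omega_ge3 i) as HX; pose proof (omega_ge3 j) as HY; pose proof (omega_ge3 k) as HZ.
assert (OX : omega i = oddR p + omega j + omega k)
  by (unfold i, omega, oddR; rewrite !plus_INR; simpl; ring).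
assert (Hm2 : 0 < oddR p ^ 2) by (apply pow_lt; lra).
assert (HXYZ : 0 < omega i * omega j * omega k) by (repeat apply Rmult_lt_0_compat; lra).
assert (Hu : 1 <= (omega j + oddR p) / omega j).
{ apply (Rmult_le_reg_r (omega j)); [lra|].
  replace ((omega j + oddR p) / omega j * omega j) with (omega j + oddR p) by (field; lra); lra. }
assert (H4 : 0 <= 4 / oddR p ^ 2) by (apply Rlt_le, Rdiv_lt_0_compat; lra).
replace (8 * K / oddR p ^ 2) with (K * (8 / oddR p ^ 2)) by (field; lra).
rewrite G_eig, Gbar_eig.
set (I := RInt (fun x => eigF i x * _) _ _) in *.
set (J := RInt (fun x => eigD i x * _) _ _) in *.
split; apply HB; try (apply Rlt_le, Rdiv_lt_0_compat; lra).
- apply Rle_trans with (4 / oddR p ^ 2 * (omega i * omega j * omega k)).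
  + eapply Rle_trans; [|exact HI].
    rewrite <- (Rmult_1_r (Rabs I)) at 1; apply Rmult_le_compat_l; [apply Rabs_pos|exact Hu].
  + apply Rmult_le_compat_r; [lra|]. replace (8 / oddR p ^ 2) with (2 * (4 / oddR p ^ 2)) by (field; lra). lra.
- set (c := (omega i ^ 2 + omega j ^ 2 - omega k ^ 2) / (2 * omega i * omega j)).
  assert (HJ : J = c * I).
  { unfold c; apply (Rmult_eq_reg_l (2 * omega i * omega j)); [|nra].
    rewrite HD; field; lra. }
  assert (Hc : 0 <= c <= 2 * ((omega j + oddR p) / omega j)).
  { unfold c; split.
    - apply Rdiv_le_0_compat; nra.
    - apply (Rmult_le_reg_r (2 * omega i * omega j)); [nra|].
      replace ((omega i ^ 2 + omega j ^ 2 - omega k ^ 2) / (2 * omega i * omega j) * (2 * omega i * omega j))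
        with (omega i ^ 2 + omega j ^ 2 - omega k ^ 2) by (field; lra).
      replace (2 * ((omega j + oddR p) / omega j) * (2 * omega i * omega j))
        with (4 * (omega j + oddR p) * omega i) by (field; lra).
      rewrite OX; nra. }
  rewrite HJ, Rabs_mult, (Rabs_pos_eq c) by tauto.
  apply Rle_trans with (2 * (Rabs I * ((omega j + oddR p) / omega j))).
  + pose proof (Rabs_pos I). replace (2 * (Rabs I * ((omega j + oddR p) / omega j))) with (2 * ((omega j + oddR p) / omega j) * Rabs I) by ring.
    apply Rmult_le_compat_r; tauto.
  + replace (8 / oddR p ^ 2 * (omega i * omega j * omega k))
      with (2 * (4 / oddR p ^ 2 * (omega i * omega j * omega k))) by (field; lra). lra.
Qed.

(** * Passage to sequences *)

(** The combination with two minus signs is 2 (i - j - k) - 3, and its divergence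
alone forces i to exceed j + k + 2 by any given amount. *)
Lemma eventually_dominates (i j k : nat -> nat) (q : nat) :
  all_combs_to_infty i j k ->
  eventually (fun n => exists p, (q <= p)%nat /\ i n = (p + j n + k n + 2)%nat).
Proof.
intros H.
assert (Hs : is_sign (-1)) by (right; reflexivity).
pose proof (H (-1) (-1) Hs Hs) as Hl.
apply is_lim_seq_spec in Hl; destruct (Hl (2 * INR q)) as [n0 Hn0].
exists n0; intros n Hn; specialize (Hn0 n Hn).
unfold omega_comb, omega in Hn0.
assert (Hlt : INR (2 * (q + j n + k n) + 3) < INR (2 * i n)).
{ rewrite plus_INR, !mult_INR, !plus_INR; simpl in *; lra. }
apply INR_lt in Hlt.
exists (i n - (j n + k n + 2))%nat; lia.
Qed.

Lemma omega_comb_minus_minus p j k : omega_comb (-1) (-1) (p + j + k + 2) j k = oddR p.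
Proof. unfold omega_comb, omega, oddR; rewrite !plus_INR; simpl; ring. Qed.

Lemma sum_pm_ge_minus_minus (f : R -> R -> R) :
  Rabs (f (-1) (-1)) <= Rabs (sum_pm (fun s t => Rabs (f s t))).
Proof.
unfold sum_pm.
pose proof (Rabs_pos (f 1 1)); pose proof (Rabs_pos (f 1 (-1)));
pose proof (Rabs_pos (f (-1) 1)); pose proof (Rabs_pos (f (-1) (-1))).
eapply Rle_trans; [|apply Rle_abs]; lra.
Qed.

(** The sum over the signs is at least its summand with two minus signs. *)
Lemma is_sum_bigO_decay (i j k : nat -> nat) (T : nat -> R) (K : R) :
  0 <= K ->
  all_combs_to_infty i j k ->
  (forall n p, i n = (p + j n + k n + 2)%nat -> Rabs (T n) <= K / oddR p ^ 2) ->
  is_sum_bigO (fun n => omega (i n) * T n)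
    (fun s t n => omega (i n) / omega_comb s t (i n) (j n) (k n) ^ 2).
Proof.
intros HK Hall HT; exists K.
generalize (eventually_dominates i j k 0 Hall); apply filter_imp.
intros n [p [_ Hp]]; specialize (HT n p Hp).
pose proof (sum_pm_ge_minus_minus (fun s t => omega (i n) / omega_comb s t (i n) (j n) (k n) ^ 2)) as Hge.
cbv beta in Hge.
apply Rle_trans with (K * Rabs (omega (i n) / omega_comb (-1) (-1) (i n) (j n) (k n) ^ 2)).
- rewrite Hp at 3; rewrite omega_comb_minus_minus.
  pose proof (omega_ge3 (i n)); pose proof (oddR_ge1 p).
  assert (0 < oddR p ^ 2) by (apply pow_lt; lra).
  rewrite Rabs_mult, (Rabs_pos_eq (omega _)), (Rabs_pos_eq (omega _ / _)).
  + replace (K * (omega (i n) / oddR p ^ 2)) with (omega (i n) * (K / oddR p ^ 2)) by (field; lra).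
    apply Rmult_le_compat_l; lra.
  + apply Rlt_le, Rdiv_lt_0_compat; lra.
  + lra.
- apply Rmult_le_compat_l; assumption.
Qed.

Lemma is_bigO_growth (i k : nat -> nat) (T : nat -> R) (K : R) :
  (forall n, Rabs (T n) <= K * omega (k n)) ->
  is_bigO (fun n => omega (i n) * T n) (fun n => omega (i n) * omega (k n)).
Proof.
intros HT; exists K; apply filter_forall; intros n.
pose proof (omega_ge3 (i n)); pose proof (omega_ge3 (k n)).
rewrite !Rabs_mult, !(Rabs_pos_eq (omega _)) by lra.
replace (K * (omega (i n) * omega (k n))) with (omega (i n) * (K * omega (k n))) by ring.
apply Rmult_le_compat_l; [lra|apply HT].
Qed.

Theorem proposition4p5 :
  forall (N : nat) (i j k : nat -> nat),
    tends_to_infty i -> tends_to_infty j -> tends_to_infty k ->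
    (~ all_combs_to_infty i j k ->
       is_bigO (fun n => omega (i n) * H0 (j n) (k n) (i n))
               (fun n => omega (i n) * omega (k n))
       /\ is_bigO (fun n => omega (i n) * G (j n) (k n) (i n))
                  (fun n => omega (i n) * omega (k n))
       /\ is_bigO (fun n => omega (i n) * Gbar (j n) (k n) (i n))
                  (fun n => omega (i n) * omega (k n)))
    /\
    (all_combs_to_infty i j k ->
       is_sum_bigO (fun n => omega (i n) * H0 (j n) (k n) (i n))
         (fun s t n => omega (i n) / omega_comb s t (i n) (j n) (k n) ^ N)
       /\ is_sum_bigO (fun n => omega (i n) * G (j n) (k n) (i n))
            (fun s t n => omega (i n) / omega_comb s t (i n) (j n) (k n) ^ 2)
       /\ is_sum_bigO (fun n => omega (i n) * Gbar (j n) (k n) (i n))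
            (fun s t n => omega (i n) / omega_comb s t (i n) (j n) (k n) ^ 2)).
Proof.
intros N i j k _ _ _; split.
- intros _; destruct growth_bounds as [K HK].
  split; [|split].
  + apply (is_bigO_growth i k (fun n => H0 (j n) (k n) (i n)) K); intros n.
    destruct (HK (i n) (j n) (k n)) as [HH _]; exact HH.
  + apply (is_bigO_growth i k (fun n => G (j n) (k n) (i n)) K); intros n.
    destruct (HK (i n) (j n) (k n)) as [_ [HG _]]; exact HG.
  + apply (is_bigO_growth i k (fun n => Gbar (j n) (k n) (i n)) K); intros n.
    destruct (HK (i n) (j n) (k n)) as [_ [_ HG]]; exact HG.
- intros Hall; destruct decay_bounds as [K [HK0 HK]]; cbv zeta in HK.
  split; [|split].
  + exists 0.
    generalize (eventually_dominates i j k 2 Hall); apply filter_imp.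
    intros n [p [Hp Hi]].
    rewrite H0_zero by lia; rewrite Rmult_0_r, Rabs_R0; lra.
  + apply (is_sum_bigO_decay i j k (fun n => G (j n) (k n) (i n)) K HK0 Hall).
    intros n p Hp; rewrite Hp; destruct (HK p (j n) (k n)) as [HG _]; exact HG.
  + apply (is_sum_bigO_decay i j k (fun n => Gbar (j n) (k n) (i n)) K HK0 Hall).
    intros n p Hp; rewrite Hp; destruct (HK p (j n) (k n)) as [_ HG]; exact HG.
Qed.
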